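(* Fix $d\ge 2$ and let $F=(F_1,\dots,F_r)$ be Gaussian polynomials over $\mathbb{R}^n$, each of degree at most $d$, such that for each $i$ we have $\mathbf{E}[F_i]=0$, $\mathbf{Var}[F_i]\le 1$ and $F_i$ is $\epsilon$-eigenregular. Let $C$ denote the covariance matrix of $F$, so $C(i,j)=\mathrm{Cov}(F_i,F_j)=\mathbf{E}_{x\sim N(0,1)^n}[F_i(x)F_j(x)]$. Let $\mathcal{G}$ be a mean-zero $r$-dimensional Gaussian random variable with covariance matrix $C$. Then for any $\alpha:\mathbb{R}^r\to\mathbb{R}$, $\alpha\in\mathcal{C}^2$, such that all second (partial) derivatives of $\alpha$ are bounded in absolute value by $\|\alpha''\|_\infty<\infty$, we have $$\left|\mathbf{E}[\alpha(F_1,\dots,F_r)]-\mathbf{E}[\alpha(\mathcal{G})]\right|\le 2^{O(d\log d)}\cdot r^2\cdot\sqrt{\epsilon}\cdot\|\alpha''\|_\infty .$$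
   Context: A Gaussian polynomial over $\mathbb{R}^n$ is a real polynomial $F(x)$ regarded as a random variable with $x\sim N(0,1)^n$; $\mathbf{E},\mathbf{Var},\mathrm{Cov}$ are with respect to this distribution. $2^{O(d\log d)}$ means at most $2^{Kd\log d}$ for an absolute constant $K$ (independent of $n,r,\epsilon,\alpha$ and the $F_i$). $\|\alpha''\|_\infty$ is the supremum over $\mathbb{R}^r$ of the absolute values of all second-order partial derivatives of $\alpha$. Tensors and chaos. Let $\mathcal{H}=\mathbb{R}^n$. $\mathcal{H}^{\otimes q}$ is the space of $q$-tensors $f=(f(i_1,\dots,i_q))_{i_1,\dots,i_q\in[n]}$ with the Euclidean inner product $\langle f,g\rangle=\sum f(i_1,\dots,i_q)g(i_1,\dots,i_q)$ and norm $\|f\|_F=\|f\|$; $\mathcal{H}^{\odot q}$ is the subspace of symmetric tensors. $H_0\equiv1$, $H_1(t)=t$, $H_q(t)=\frac{(-1)^q}{q!}e^{t^2/2}\frac{d^q}{dt^q}e^{-t^2/2}$. The linear map $I_q$ from $\mathcal{H}^{\odot q}$ to polynomials in $x$ is determined by $I_q(h^{\otimes q})=q!\,H_q(\langle h,x\rangle)$ for unit vectors $h\in\mathbb{R}^n$ (and $I_0(c)=c$); it is a bijection onto its image $\mathcal{W}^q$, the $q$-th Wiener chaos. Every polynomial $F$ of degree at most $d$ has a unique decomposition $F=\sum_{q=0}^d I_q(f_q)$ with $f_q\in\mathcal{H}^{\odot q}$. Eigenregularity. For $p\ge2$ and $g\in\mathcal{H}^{\odot p}$, for a partition of $[p]$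 into non-empty $S,\overline S$ let $\lambda_{S,\overline S}(g)=\sup_{x\in\mathcal{H}^{\otimes S},\,y\in\mathcal{H}^{\otimes\overline S}}\frac{\langle g,x\otimes y\rangle}{\|x\|_F\|y\|_F}$ (nonzero $x,y$, with the coordinates in $S$ paired with $x$ and those in $\overline S$ with $y$), and $\lambda_{\max}(g)=\max_{S,\overline S\neq\emptyset}\lambda_{S,\overline S}(g)$; for $p\in\{0,1\}$, $\lambda_{\max}(g)=0$. For $F=\sum_{q=0}^dI_q(f_q)$, $\lambda_{\max}(F)=\max\{\lambda_{\max}(f_2),\dots,\lambda_{\max}(f_d)\}$. $F$ is $\epsilon$-eigenregular if $\lambda_{\max}(F)/\sqrt{\mathbf{Var}[F]}\le\epsilon$; a polynomial of degree at most 1 (including the zero polynomial) is by convention $0$-eigenregular, hence $\epsilon$-eigenregular for every $\epsilon>0$. *)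

(* Defs.v *)
From HB Require Import structures.
From mathcomp Require Import all_boot all_order all_algebra perm.
From mathcomp Require Import all_classical all_reals all_analysis.
(* Its notations clash with those of mathcomp-analysis. *)
From mathcomp Require Import -(notations) mpoly.

Set Implicit Arguments.
Unset Strict Implicit.
Unset Printing Implicit Defensive.

Import Order.TTheory GRing.Theory Num.Theory.
Import numFieldNormedType.Exports.

Local Open Scope classical_set_scope.
Local Open Scope ring_scope.

Section StandardGaussian.
Context {R : realType}.

Definition tuple_cons n (p : measurableTypeR R * n.-tuple R) : n.+1.-tuple R :=
  [tuple of p.1 :: p.2].

Lemma measurable_tuple_cons n :
  measurable_fun [set: measurableTypeR R * n.-tuple R] (@tuple_cons n).
Proof.
by apply: measurable_cons; [exact: measurable_fst | exact: measurable_snd].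
Qed.

HB.instance Definition _ n := isMeasurableFun.Build _ _ _ _
  (@tuple_cons n) (@measurable_tuple_cons n).

(* N(0,1)^n, as the image of N(0,1) x N(0,1)^(n-1) under (t, x) |-> t :: x. *)
Fixpoint std_gaussian (n : nat) : probability (n.-tuple R) R :=
  match n return probability (n.-tuple R) R with
  | 0 => \d_([tuple])
  | m.+1 => distribution (normal_prob 0 1 \x std_gaussian m)%E (@tuple_cons m)
  end.

(* Gaussian random vectors (possibly degenerate): G has the law of m + A z,
   where z ~ N(0,1)^k.  Mean and covariance are constrained separately. *)
Definition gaussian_vector d (T : measurableType d) (Q : probability T R)
    (r : nat) (G : {RV Q >-> r.-tuple R}) : Prop :=
  exists (k : nat) (A : 'M[R]_(r, k)) (m : 'I_r -> R),
    forall B : set (r.-tuple R), measurable B ->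
      distribution Q G B = std_gaussian k
        [set z | B [tuple m i + \sum_(j < k) A i j * tnth z j | i < r]].

End StandardGaussian.

Section Tensors.
Context {R : realType} {n : nat}.

(* Tensors with coordinates labelled by a finite type J; the q-tensors are
   [tensor 'I_q], and the tensors over S are [tensor {j | j \in S}]. *)
Definition tensor (J : finType) : Type := {ffun {ffun J -> 'I_n} -> R}.

Definition tensor_dot (J : finType) (f g : tensor J) : R :=
  \sum_(i : {ffun J -> 'I_n}) f i * g i.

Definition tensor_norm (J : finType) (f : tensor J) : R :=
  Num.sqrt (tensor_dot f f).

Definition symmetric_tensor q (f : tensor 'I_q) : Prop :=
  forall (s : {perm 'I_q}) (i : {ffun 'I_q -> 'I_n}),
    f [ffun j => i (s j)] = f i.

Definition subindex p (S : {set 'I_p}) (i : {ffun 'I_p -> 'I_n}) :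
    {ffun {j : 'I_p | j \in S} -> 'I_n} :=
  [ffun j => i (val j)].

Definition tensor_prod p (S : {set 'I_p}) (x : tensor {j : 'I_p | j \in S})
    (y : tensor {j : 'I_p | j \in ~: S}) : tensor 'I_p :=
  [ffun i => x (subindex S i) * y (subindex (~: S) i)].

Definition lambda_part p (g : tensor 'I_p) (S : {set 'I_p}) : R :=
  sup [set v | exists (x : tensor {j : 'I_p | j \in S})
                      (y : tensor {j : 'I_p | j \in ~: S}),
    [/\ x <> [ffun=> 0], y <> [ffun=> 0] &
        v = tensor_dot g (tensor_prod x y) / (tensor_norm x * tensor_norm y)]].

(* Each [lambda_part g S] is nonnegative, so starting the maximum at 0 is
   harmless; it gives 0 when p <= 1, where no partition exists. *)
Definition lambda_max p (g : tensor 'I_p) : R :=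
  \big[Num.max/0]_(S : {set 'I_p} |
      (S != finset.set0) && (~: S != finset.set0)) lambda_part g S.

End Tensors.
Arguments tensor R n J : clear implicits.

Section Chaos.
Context {R : realType}.

Definition hermite (q : nat) (t : R) : R :=
  (-1) ^+ q / q`!%:R * expR (t ^+ 2 / 2)
  * derive1n q (fun s : R => expR (- (s ^+ 2 / 2))) t.

(* [is_chaos q f P] means P = I_q(f), P being seen as a function on R^n:
   the graph of the linear extension of h^{(x)q} |-> q! H_q(<h, x>) from unit
   vectors h to their linear combinations, which are all the symmetric
   q-tensors.  The case q = 0 is apart because R^0 has no unit vector. *)
Definition is_chaos (n q : nat) (f : tensor R n 'I_q)
    (P : n.-tuple R -> R) : Prop :=
  if q == 0%N then
    exists c : R, (forall i, f i = c) /\ (forall x, P x = c)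
  else
    exists (m : nat) (c : 'I_m -> R) (h : 'I_m -> 'I_n -> R),
      [/\ forall k, \sum_(j < n) h k j ^+ 2 = 1,
          forall i, f i = \sum_(k < m) c k * \prod_(j < q) h k (i j) &
          forall x, P x = \sum_(k < m) c k *
            (q`!%:R * hermite q (\sum_(j < n) h k j * tnth x j))].

Definition peval (n : nat) (F : mpoly n R) (x : n.-tuple R) : R :=
  meval (tnth x) F.

Definition chaos_decomposition (n d : nat) (F : mpoly n R)
    (f : forall q : nat, tensor R n 'I_q) : Prop :=
  exists P : nat -> n.-tuple R -> R,
    (forall q, (q <= d)%N -> symmetric_tensor (f q) /\ is_chaos (f q) (P q)) /\
    forall x, peval F x = \sum_(q < d.+1) P q x.

(* For F of degree at most 1 the maximum is 0, hence so is the ratio, also when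
   the variance is 0 because x / 0 = 0: such an F is 0-eigenregular. *)
Definition eigenregular (n d : nat) (eps : R) (F : mpoly n R) : Prop :=
  exists f : forall q : nat, tensor R n 'I_q,
    chaos_decomposition d F f /\
    \big[Num.max/0]_(2 <= q < d.+1) lambda_max (f q)
      / Num.sqrt (fine (variance (std_gaussian n) (peval F))) <= eps.

End Chaos.

Section SmoothFunctions.
Context {R : realType} {r : nat}.

Definition partial (i : 'I_r) (a : 'rV[R]_r -> R) : 'rV[R]_r -> R :=
  fun x => 'D_(delta_mx 0 i) a x.

Definition C1 (a : 'rV[R]_r -> R) : Prop :=
  [/\ continuous a,
      forall i x, derivable a x (delta_mx 0 i) &
      forall i, continuous (partial i a)].

Definition C2 (a : 'rV[R]_r -> R) : Prop :=
  C1 a /\ forall i, C1 (partial i a).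

Definition second_partials (a : 'rV[R]_r -> R) : set R :=
  [set v | exists i j x, v = `|partial i (partial j a) x| ].

End SmoothFunctions.

(* Main.v *)
(* Interpolate by W(t) = sin t F + cos t G between F and G, realized on
   independent standard Gaussian coordinates.  With N the number operator and
   F_a = N U_a, G_a = N U'_a (U'_a = G_a, being linear), Gaussian integration by
   parts gives
     d/dt E[alpha(W)] =
       sin t cos t sum_(a,b) E[(<grad U_a, grad F_b> - C_ab) (d_b d_a alpha)(W)],
   and E <grad U_a, grad F_b> = C_ab, so only Var <grad U_a, grad F_b> is needed.
   Parseval's identity E[PQ] = sum_m (1/m!) sum_(|s|=m) E[d_s P] E[d_s Q] turns
   this variance into norms of contractions of the chaos tensors in which at
   least one leg is left free, each bounded by lambda_max times a Hilbert-Schmidt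
   norm.  As lambda_max is at most eps and at most 1, its square is at most eps,
   whence the factor sqrt eps. *)
Require Import Defs.
From HB Require Import structures.
From mathcomp Require Import all_boot all_order all_algebra perm.
From mathcomp Require Import all_classical all_reals all_analysis.
From mathcomp Require Import -(notations) mpoly.
From mathcomp Require Import measurable_realfun ring lra zify.

Set Implicit Arguments.
Unset Strict Implicit.
Unset Printing Implicit Defensive.

Import Order.TTheory GRing.Theory Num.Theory.
Import numFieldNormedType.Exports.

Local Open Scope classical_set_scope.
Local Open Scope ring_scope.

(** * Parseval's identity and contractions *)

(** No inverse of the number operator is constructed: eigenregularity supplies a chaos
    decomposition, and dividing its components by their orders yields [u] with F = N u. All that is
    needed of F and [u] is then contained in the numbers E[d_s F], which at order q are q! times the
    entries of f_q; orthogonality of the chaoses appears as the vanishing of these numbers at all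
    other orders. Up to the variance bound the argument is algebra about a linear functional with
    E[1] = 1 and E[x_j p] = E[d_j p]. Measure theory is confined to proving the second property for
    the Gaussian expectation, together with its analogue when a smooth function of polynomials is a
    factor. Free legs matter because eigenvalues control only flattenings with both sides non-empty:
    the gradient product always contracts a leg, and subtracting the squared mean removes the terms
    in which no leg is free. *)

Section SequenceSums.
Context {R : realFieldType} {n : nat}.
Implicit Types (f g : seq 'I_n -> R) (m k : nat).

(* Tensors of order m are encoded as functions on words of length m. *)
Fixpoint seqsum m f : R :=
  if m is m'.+1 then \sum_(j < n) seqsum m' (fun s => f (j :: s)) else f [::].

Lemma eq_seqsum m f g : (forall s, size s = m -> f s = g s) ->
  seqsum m f = seqsum m g.
Proof.
elim: m f g => [|m IH] f g fg /=; first exact: fg.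
by apply: eq_bigr => j _; apply: IH => s sm; apply: fg; rewrite /= sm.
Qed.

Lemma seqsum0 m f : (forall s, size s = m -> f s = 0) -> seqsum m f = 0.
Proof.
elim: m f => [|m IH] f f0 /=; first exact: f0.
by apply: big1 => j _; apply: IH => s sm; apply: f0; rewrite /= sm.
Qed.

Lemma seqsumD m f g : seqsum m (fun s => f s + g s) = seqsum m f + seqsum m g.
Proof. by elim: m f g => //= m IH f g; rewrite -big_split; apply: eq_bigr. Qed.

Lemma seqsumZ m c f : seqsum m (fun s => c * f s) = c * seqsum m f.
Proof. by elim: m f => //= m IH f; rewrite mulr_sumr; apply: eq_bigr. Qed.

Lemma seqsum_sum (I : Type) (r : seq I) (P : pred I) m (f : I -> seq 'I_n -> R) :
  seqsum m (fun s => \sum_(i <- r | P i) f i s) =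
  \sum_(i <- r | P i) seqsum m (f i).
Proof.
elim: m f => //= m IH f; rewrite exchange_big /=.
by apply: eq_bigr => j _; rewrite IH.
Qed.

Lemma le_seqsum m f g : (forall s, size s = m -> f s <= g s) ->
  seqsum m f <= seqsum m g.
Proof.
elim: m f g => [|m IH] f g fg /=; first exact: fg.
by apply: ler_sum => j _; apply: IH => s sm; apply: fg; rewrite /= sm.
Qed.

Lemma seqsum_ge0 m f : (forall s, 0 <= f s) -> 0 <= seqsum m f.
Proof.
by move=> f0; rewrite -(@seqsum0 m (fun=> 0)) //; apply: le_seqsum.
Qed.

Lemma seqsum_cat m k f :
  seqsum (m + k) f = seqsum m (fun s => seqsum k (fun t => f (s ++ t))).
Proof. by elim: m f => //= m IH f; apply: eq_bigr. Qed.

Lemma seqsum_exchange m k (f : seq 'I_n -> seq 'I_n -> R) :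
  seqsum m (fun s => seqsum k (f s)) =
  seqsum k (fun t => seqsum m (fun s => f s t)).
Proof.
elim: m f => //= m IH f; rewrite seqsum_sum.
by apply: eq_bigr => j _; rewrite IH.
Qed.

(** A word is determined by its letters at the true and at the false positions of [b], which vary
    independently. This separates the indices carried by the two factors of a product. *)
Lemma seqsum_mask (b : bitseq) (f : seq 'I_n -> seq 'I_n -> R) :
  seqsum (size b) (fun s => f (mask b s) (mask (map negb b) s)) =
  seqsum (count id b) (fun u => seqsum (count negb b) (f u)).
Proof.
elim: b f => //= -[] b IH f /=.
- rewrite add0n; apply: eq_bigr => j _.
  exact: (IH (fun u v => f (j :: u) v)).
- rewrite add0n /=.
  under eq_bigr => j _ do rewrite (IH (fun u v => f u (j :: v))).
  by rewrite -seqsum_sum.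
Qed.

(** [codom i] lists the values of [i] in order: it is the word encoding the index [i]. This links
    words to the tensors of the statement. *)
Lemma seqsum_ffun m f :
  seqsum m f = \sum_(i : {ffun 'I_m -> 'I_n}) f (codom i).
Proof.
elim: m f => [|m IH] f /=.
  have i0 : {ffun 'I_0 -> 'I_n} by apply: finfun => -[].
  rewrite (big_pred1 i0).
    by rewrite codomE enum_ord0.
  by move=> i; apply/esym/eqP/ffunP => -[].
under eq_bigr => j _ do rewrite IH.
rewrite pair_big /=.
pose h (p : 'I_n * {ffun 'I_m -> 'I_n}) : {ffun 'I_m.+1 -> 'I_n} :=
  [ffun i => if unlift ord0 i is Some k then p.2 k else p.1].
pose h' (i : {ffun 'I_m.+1 -> 'I_n}) : 'I_n * {ffun 'I_m -> 'I_n} :=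
  (i ord0, [ffun k => i (lift ord0 k)]).
rewrite [RHS](reindex h); last first.
  exists h' => [[j i] _|i _] /=.
    rewrite /h' /h ffunE unlift_none; congr (_, _).
    by apply/ffunP => k; rewrite !ffunE liftK.
  apply/ffunP => k; rewrite ffunE; case: unliftP => [l ->|->] //=.
  by rewrite ffunE.
apply: eq_bigr => -[j i] _ /=; congr f.
rewrite !codomE enum_ordSl /= ffunE unlift_none; congr cons.
rewrite -map_comp; apply: eq_map => k /=.
by rewrite ffunE liftK.
Qed.

Lemma seqsum_cauchy_schwarz m f g :
  seqsum m (fun s => f s * g s) ^+ 2 <=
  seqsum m (fun s => f s ^+ 2) * seqsum m (fun s => g s ^+ 2).
Proof.
set a := seqsum m (fun s => f s ^+ 2); set b := seqsum m (fun s => g s ^+ 2).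
set c := seqsum _ _.
have b0 : 0 <= b by apply: seqsum_ge0 => s; apply: sqr_ge0.
have a0 : 0 <= a by apply: seqsum_ge0 => s; apply: sqr_ge0.
have H t : 0 <= a + 2 * t * c + t ^+ 2 * b.
  rewrite -!seqsumZ -!seqsumD; apply: seqsum_ge0 => s.
  have -> : f s ^+ 2 + 2 * t * (f s * g s) + t ^+ 2 * g s ^+ 2 =
    (f s + t * g s) ^+ 2 by ring.
  exact: sqr_ge0.
have [b_eq0|b_neq0] := eqVneq b 0.
  have [->|c_neq0] := eqVneq c 0; first by rewrite expr0n mulr_ge0.
  (* With [b = 0] the quadratic is affine in [t], and this [t] gives it the value -1. For [b > 0]
     the minimizer [- c / b] is used below. *)
  have := H (- (a + 1) / (2 * c)); rewrite b_eq0 mulr0 addr0.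
  have -> : 2 * (- (a + 1) / (2 * c)) * c = - (a + 1) by field.
  lra.
have := H (- c / b).
have -> : a + 2 * (- c / b) * c + (- c / b) ^+ 2 * b = (a * b - c ^+ 2) / b by field.
by rewrite pmulr_lge0 ?invr_gt0 ?lt0r ?b_neq0// subr_ge0.
Qed.

End SequenceSums.

Section Parseval.
Context {R : realFieldType} {n : nat}.
Local Notation poly := (mpoly n R).
Local Notation var i := (mpolyX R (mnm1 i)).
Implicit Types (p q : poly) (s t u : seq 'I_n).

Lemma mnm_neq0_ex (m : multinom n) : m <> @mnm0 n ->
  exists j m', m = mnm_add (mnm1 j) m'.
Proof.
move=> m0; have /existsP[j mj] : [exists j, m j != 0%N].
  apply: contra_notT m0; rewrite negb_exists => /forallP m0.
  by apply/mnmP => j; rewrite mnm0E; apply/eqP; rewrite -[_ == _]negbK.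
by exists j, (mnm_sub m (mnm1 j)); rewrite addmC submK// lep1mP.
Qed.

(** Multiplication by one variable at a time suits evaluation, derivation and relabelling, which are
    all known on products. *)
Lemma mpoly_alg_ind (P : poly -> Prop) :
  (forall c, P (mpolyC n c)) ->
  (forall p q, P p -> P q -> P (p + q)) ->
  (forall j p, P p -> P (var j * p)) ->
  forall p, P p.
Proof.
move=> PC PD PX; elim/mpolyind => [|c m p _ _ Pp]; first by rewrite -mpolyC0.
apply: PD => //; rewrite -mul_mpolyC {p Pp}.
have [k] := ubnP (mdeg m); elim: k m => // k IH m mk.
have [m0|/eqP m0] := eqVneq m mnm0; first by rewrite m0 mpolyX0 mulr1.
have [j [m' mE]] := mnm_neq0_ex m0.
move: mk {m0}; rewrite {m}mE => mk.
rewrite mpolyXD mulrCA; apply: PX; apply: IH.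
by move: mk; rewrite mdegD mdeg1 add1n ltnS.
Qed.

Lemma mderiv_var i j : mderiv i (var j) = (i == j)%:R :> poly.
Proof.
rewrite mderivX mnm1E eq_sym; case: eqP => [->|_]; last by rewrite scale0r.
suff -> : mnm_sub (mnm1 j) (mnm1 j) = mnm0 by rewrite mpolyX0 scale1r.
by apply/mnmP => k; rewrite mnmBE subnn mnm0E.
Qed.

Definition dseq s p : poly := foldl (fun p j => mderiv j p) p s.

Lemma dseq_is_linear s : linear (dseq s).
Proof. by elim: s => //= j s IH c p q /=; rewrite linearP IH. Qed.
HB.instance Definition _ s := GRing.isLinear.Build R poly poly _ (dseq s)
  (dseq_is_linear s).

Lemma dseq_mderiv s j p : dseq s (mderiv j p) = mderiv j (dseq s p).
Proof. by elim: s p => //= i s IH p; rewrite mderiv_comm IH. Qed.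

Lemma dseq_cat s t p : dseq (s ++ t) p = dseq t (dseq s p).
Proof. by rewrite /dseq foldl_cat. Qed.

Lemma dseq_catC s t p : dseq (s ++ t) p = dseq (t ++ s) p.
Proof.
rewrite !dseq_cat; elim: t p => //= j t IH p.
by rewrite -dseq_mderiv IH.
Qed.

Fixpoint bitmasks k : seq bitseq :=
  if k is k'.+1 then map (cons true) (bitmasks k') ++ map (cons false) (bitmasks k')
  else [:: [::]].

Lemma size_bitmasks k : size (bitmasks k) = (2 ^ k)%N.
Proof. by elim: k => //= k IH; rewrite size_cat !size_map IH addnn expnS mul2n. Qed.

Lemma mem_bitmasks k b : b \in bitmasks k -> size b = k.
Proof.
elim: k b => [|k IH] b /=; first by rewrite inE => /eqP->.
by rewrite mem_cat => /orP[] /mapP[b' /IH <- ->].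
Qed.

(** Leibniz' rule without multinomial coefficients: the mask tells which letters differentiate [p],
    and equal letters are kept apart by their positions. *)
Lemma dseqM s p q : dseq s (p * q) =
  \sum_(b <- bitmasks (size s)) dseq (mask b s) p * dseq (mask (map negb b) s) q.
Proof.
elim: s p q => [|j s IH] p q /=; first by rewrite big_seq1.
by rewrite big_cat !big_map /= mderivM linearD /= !IH.
Qed.

(* Of the Gaussian expectation, the algebraic part uses only these two properties. *)
Context (E : {scalar poly}).
Hypothesis E1 : E 1 = 1.
Hypothesis Eibp : forall j p, E (var j * p) = E (mderiv j p).

(* For p = sum_q I_q(f_q) this is (size s)! times the entry of f_(size s) at s. *)
Definition ecoef p s : R := E (dseq s p).

Definition ecoef_dot m p q : R := seqsum m (fun s => ecoef p s * ecoef q s).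

Lemma ecoef_dotS m p q :
  ecoef_dot m.+1 p q = \sum_(j < n) ecoef_dot m (mderiv j p) (mderiv j q).
Proof. by []. Qed.

Lemma ecoef_dotDr m p q1 q2 :
  ecoef_dot m p (q1 + q2) = ecoef_dot m p q1 + ecoef_dot m p q2.
Proof.
rewrite /ecoef_dot -seqsumD; apply: eq_seqsum => s _.
by rewrite /ecoef !linearD mulrDr.
Qed.

Lemma ecoef_dotZr m p c q : ecoef_dot m p (c *: q) = c * ecoef_dot m p q.
Proof.
rewrite /ecoef_dot -seqsumZ; apply: eq_seqsum => s _.
by rewrite /ecoef !linearZ /= mulrCA.
Qed.

(** Differentiating x_j q along s gives x_j d_s q, which [Eibp] turns into a derivative, plus one
    term for each position of s that holds j. By symmetry the m positions contribute equally. At m =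
    0 the factor [m%:R] makes the value of [m.-1] irrelevant. *)
Lemma ecoef_dot_var m p q j : ecoef_dot m p (var j * q) =
  ecoef_dot m p (mderiv j q) + m%:R * ecoef_dot m.-1 (mderiv j p) q.
Proof.
elim: m p q => [|m IH] p q.
  by rewrite mul0r addr0 /ecoef_dot /= /ecoef /= Eibp.
rewrite !ecoef_dotS.
have dv k : mderiv k (var j * q) = ((k == j)%:R : R) *: q + var j * mderiv k q.
  rewrite mderivM mderiv_var; congr (_ + _).
  by case: (k == j); rewrite ?mul1r ?scale1r ?mul0r ?scale0r.
under eq_bigr => k _ do rewrite dv ecoef_dotDr IH.
rewrite big_split /=; under [X in X + _]eq_bigr => k _ do rewrite ecoef_dotZr.
rewrite (bigD1 j) //= eqxx mul1r [X in (_ + X) + _]big1 ?addr0; last first.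
  by move=> k /negPf->; rewrite mul0r.
rewrite big_split /= addrCA; congr (_ + _).
  by apply: eq_bigr => k _; rewrite mderiv_comm.
rewrite -mulr_sumr; case: m {IH} => [|m].
  by rewrite mul0r addr0 mul1r.
rewrite !succnK.
have -> : \sum_(k < n) ecoef_dot m (mderiv j (mderiv k p)) (mderiv k q) =
  ecoef_dot m.+1 (mderiv j p) q.
  by rewrite ecoef_dotS; apply: eq_bigr => k _; rewrite mderiv_comm.
by rewrite -[in RHS]natr1; ring.
Qed.

(** Removing a variable x_j from the monomial by [Eibp] leaves two expectations with monomials of
    lower degree, one with d_j on [p] and one with d_j on the monomial. On the right [ecoef_dot_var]
    splits in the same way, k / k! = 1 / (k-1)! accounting for the shift of order. *)
Lemma parseval_monomial M p m : (mdeg m < M)%N ->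
  E (p * mpolyX R m) = \sum_(k < M) (k`!%:R)^-1 * ecoef_dot k p (mpolyX R m).
Proof.
have [N] := ubnP (mdeg m); elim: N M m p => // N IH M m p mN mM.
have [m0|/eqP m0] := eqVneq m mnm0.
  rewrite m0 mpolyX0 mulr1; case: M mM => // M _.
  rewrite big_ord_recl /= big1 => [|k _].
    by rewrite addr0 invr1 mul1r /ecoef_dot /= /ecoef /= E1 mulr1.
  rewrite /= /ecoef_dot /= big1 ?mulr0// => j _; apply: seqsum0 => s _.
  by rewrite /ecoef /= -mpolyC1 mderivC !linear0 mulr0.
have [j [m' mE]] := mnm_neq0_ex m0.
move: mN mM {m0}; rewrite {m}mE mdegD mdeg1 add1n => mN mM.
case: M mM => // M mM.
rewrite mpolyXD mulrCA Eibp mderivM linearD /= (IH M m' (mderiv j p))//.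
have -> : E (p * mderiv j (mpolyX R m')) = \sum_(k < M.+1) (k`!%:R)^-1 *
    ecoef_dot k p (mderiv j (mpolyX R m')).
  have m'N : (mdeg (mnm_sub m' (mnm1 j)) < N)%N.
    by rewrite (leq_ltn_trans (mdegB _ _)).
  have m'M : (mdeg (mnm_sub m' (mnm1 j)) < M.+1)%N.
    by rewrite (leq_ltn_trans (mdegB _ _))// ltnW.
  rewrite mderivX -scalerAr linearZ /= (IH M.+1)// mulr_sumr.
  by apply: eq_bigr => k _; rewrite ecoef_dotZr mulrCA.
rewrite addrC; under [RHS]eq_bigr => k _ do rewrite ecoef_dot_var mulrDr.
rewrite big_split /=; congr (_ + _).
rewrite [RHS]big_ord_recl mul0r mulr0 add0r /=.
apply: eq_bigr => k _.
rewrite /bump /= add1n mulrA; congr (_ * _).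
rewrite factS natrM invfM mulrAC mulVf ?mul1r// pnatr_eq0.
Qed.

Lemma parseval M p q : (forall s, (M <= size s)%N -> ecoef q s = 0) ->
  E (p * q) = \sum_(k < M) (k`!%:R)^-1 * ecoef_dot k p q.
Proof.
(* [msize q] makes [N] exceed the degree of each monomial of [q]; the terms from [M] on then vanish
   by [qM]. *)
move=> qM; pose N := maxn M (msize q).
have -> : E (p * q) = \sum_(k < N) (k`!%:R)^-1 * ecoef_dot k p q.
  have dotD k : ecoef_dot k p q =
      \sum_(m <- msupp q) mcoeff m q * ecoef_dot k p (mpolyX R m).
    rewrite /ecoef_dot -[LHS]/(seqsum k _).
    under [RHS]eq_bigr => m _ do rewrite -seqsumZ.
    rewrite -seqsum_sum; apply: eq_seqsum => s _.
    rewrite {1}(mpolyE q) /ecoef linear_sum linear_sum mulr_sumr.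
    by apply: eq_bigr => m _; rewrite !linearZ /= mulrCA.
  rewrite {1}(mpolyE q) mulr_sumr linear_sum /=.
  under [RHS]eq_bigr => k _ do rewrite dotD mulr_sumr.
  rewrite exchange_big /=; rewrite big_seq [RHS]big_seq.
  apply: eq_bigr => m mq; rewrite -scalerAr linearZ /=.
  rewrite (@parseval_monomial N); last first.
    by rewrite leq_max msize_mdeg_lt ?orbT.
  by rewrite mulr_sumr; apply: eq_bigr => k _; rewrite mulrCA.
have MN : (M <= N)%N by rewrite leq_maxl.
rewrite (big_ord_widen _ (fun k => (k`!%:R)^-1 * ecoef_dot k p q) MN).
rewrite [RHS]big_mkcond /=; apply: eq_bigr => k _.
case: ltnP => // Mk; rewrite /ecoef_dot seqsum0 ?mulr0// => s sk.
by rewrite qM ?mulr0// sk.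
Qed.

End Parseval.

Section Contraction.
Context {R : realFieldType} {n : nat}.
Implicit Types (f g : seq 'I_n -> R).

Lemma sqr_sum_le (I : Type) (r : seq I) (a : I -> R) :
  (\sum_(i <- r) a i) ^+ 2 <= (size r)%:R * \sum_(i <- r) a i ^+ 2.
Proof.
elim: r => [|i r IH]; first by rewrite !big_nil expr0n mulr0.
rewrite !big_cons /= -natr1; set S := \sum_(j <- r) a j in IH *.
set Q := \sum_(j <- r) a j ^+ 2 in IH *.
have H : 2 * (a i * S) <= (size r)%:R * a i ^+ 2 + Q.
  rewrite /S /Q; elim: (r) => [|j r' IH']; first by rewrite !big_nil !mulr0 mul0r addr0.
  rewrite !big_cons /= -natr1.
  have := sqr_ge0 (a i - a j); lra.
rewrite sqrrD -mulr_natl; lra.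
Qed.

(* The flattenings of f of shape (m, a), with both sides non-empty, have squared
   operator norm at most L. *)
Definition contracts f (L : R) := forall m a (x : seq 'I_n -> R), (0 < m)%N -> (0 < a)%N ->
  seqsum a (fun u => seqsum m (fun l => f (l ++ u) * x l) ^+ 2) <=
  L * seqsum m (fun l => x l ^+ 2).

(** As [b] is non-empty, [f] or [g] keeps a free leg. That factor acts as an operator of squared
    norm at most [L] on the slices of the other one, whose squared norms add up to at most [B]. *)
Lemma seqsum_contraction f g (L B : R) m b :
  0 <= L -> (0 < m)%N -> (0 < size b)%N -> contracts f L -> contracts g L ->
  (forall q, seqsum q (fun s => f s ^+ 2) <= B) ->
  (forall q, seqsum q (fun s => g s ^+ 2) <= B) ->
  seqsum (size b) (fun i => seqsum m (fun l =>
    f (l ++ mask b i) * g (l ++ mask (map negb b) i)) ^+ 2) <= L * B.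
Proof.
move=> L0 m0 b0 cf cg fB gB.
rewrite (seqsum_mask b (fun u v => seqsum m (fun l => f (l ++ u) * g (l ++ v)) ^+ 2)).
have [a0|a0] := posnP (count id b).
  have c0 : (0 < count negb b)%N.
    by rewrite -(count_predC id) a0 add0n in b0.
  apply: (@le_trans _ _ (seqsum (count id b) (fun u => L * seqsum m (fun l => f (l ++ u) ^+ 2)))).
    apply: le_seqsum => u _; under eq_seqsum => v _.
      under eq_seqsum => l _ do rewrite mulrC.
      over.
    exact: cg.
  rewrite seqsumZ seqsum_exchange -(seqsum_cat _ _ (fun s => f s ^+ 2)).
  by apply: ler_wpM2l.
rewrite seqsum_exchange.
apply: (@le_trans _ _ (seqsum (count negb b) (fun v => L * seqsum m (fun l => g (l ++ v) ^+ 2)))).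
  by apply: le_seqsum => v _; exact: cf.
rewrite seqsumZ seqsum_exchange -(seqsum_cat _ _ (fun s => g s ^+ 2)).
by apply: ler_wpM2l.
Qed.

End Contraction.

(** * Variance of a product of gradients *)

Section GradientDot.
Context {R : realFieldType} {n : nat}.
Local Notation poly := (mpoly n R).
Local Notation var i := (mpolyX R (mnm1 i)).
Implicit Types (p q : poly).
Context (E : {scalar poly}).
Hypothesis E1 : E 1 = 1.
Hypothesis Eibp : forall j p, E (var j * p) = E (mderiv j p).
Local Notation ecoef := (ecoef E).

Definition grad_dot p q : poly := \sum_(j < n) mderiv j p * mderiv j q.

Lemma ecoef_rcons j s p : ecoef (mderiv j p) s = ecoef p (j :: s).
Proof. by []. Qed.

Lemma ecoef_dseq s t p : ecoef (dseq s p) t = ecoef p (t ++ s).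
Proof. by rewrite /ecoef -dseq_cat dseq_catC. Qed.

(** Leibniz' rule distributes the letters of [s], and Parseval's identity expands each expectation
    of a product. The direction of the gradient joins the m summed legs, so m.+1 >= 1 legs are
    contracted. *)
Lemma ecoef_grad_dot d p q s :
  (forall s, (d < size s)%N -> ecoef q s = 0) ->
  ecoef (grad_dot p q) s = \sum_(b <- bitmasks (size s)) \sum_(m < d)
    (m`!%:R)^-1 * seqsum m.+1 (fun l =>
      ecoef p (l ++ mask b s) * ecoef q (l ++ mask (map negb b) s)).
Proof.
move=> qd; rewrite /ecoef /grad_dot !linear_sum /=.
under eq_bigr => j _ do rewrite dseqM linear_sum /=.
rewrite exchange_big /=; apply: eq_bigr => b _.
under eq_bigr => j _.
  rewrite (parseval E1 Eibp (M := d)); last first.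
    by move=> t dt; rewrite ecoef_dseq ecoef_rcons qd//= size_cat ltnS (leq_trans dt)// leq_addr.
  over.
rewrite exchange_big /=; apply: eq_bigr => m _; rewrite -mulr_sumr.
congr (_ * _); apply: eq_bigr => j _; apply: eq_seqsum => t _.
by rewrite !ecoef_dseq.
Qed.

(** One of the factors receives at least [d] letters of [s] besides a contracted one, so its
    coefficient has order above [d]. *)
Lemma ecoef_grad_dot_eq0 d p q s :
  (forall s, (d < size s)%N -> ecoef p s = 0) ->
  (forall s, (d < size s)%N -> ecoef q s = 0) ->
  (d.*2 <= size s)%N -> ecoef (grad_dot p q) s = 0.
Proof.
move=> pd qd ds; rewrite (ecoef_grad_dot _ _ qd) big_seq big1// => b /mem_bitmasks bs.
apply: big1 => m _; rewrite seqsum0 ?mulr0// => l lm.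
have /orP[h|h] : (d <= size (mask b s))%N || (d <= size (mask (map negb b) s))%N.
- rewrite !size_mask ?size_map// count_map.
  rewrite -[count (preim _ _) b]/(count (predC id) b).
  have := count_predC id b; rewrite bs => cb.
  rewrite -addnn -cb in ds.
  by apply: contraTT ds; rewrite negb_or -!ltnNge => /andP[h1 h2]; rewrite -addnS leq_add// ltnW.
- by rewrite pd ?mul0r// size_cat lm addSn ltnS (leq_trans h)// leq_addl.
- by rewrite qd ?mulr0// size_cat lm addSn ltnS (leq_trans h)// leq_addl.
Qed.

(** There are [2 ^ k] masks and [d] contraction lengths. This number enters twice: in bounding the
    square of the sum by the sum of squares, and in adding up the bounds on the terms. The weights
    1/m! are bounded by 1. *)
Lemma ecoef_grad_dot_norm d p q (L B : R) k :
  (0 < k)%N -> 0 <= L ->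
  (forall s, (d < size s)%N -> ecoef q s = 0) ->
  contracts (ecoef p) L -> contracts (ecoef q) L ->
  (forall m, seqsum m (fun s => ecoef p s ^+ 2) <= B) ->
  (forall m, seqsum m (fun s => ecoef q s ^+ 2) <= B) ->
  ecoef_dot E k (grad_dot p q) (grad_dot p q) <=
    ((2 ^ k * d)%:R) ^+ 2 * (L * B).
Proof.
move=> k0 L0 qd cp cq pB qB; rewrite /ecoef_dot.
pose r := [seq (b, m) | b <- bitmasks k, m <- iota 0 d].
pose T (bm : bitseq * nat) s := seqsum bm.2.+1 (fun l =>
      ecoef p (l ++ mask bm.1 s) * ecoef q (l ++ mask (map negb bm.1) s)).
have sr : size r = (2 ^ k * d)%N by rewrite size_allpairs size_bitmasks size_iota.
apply: (@le_trans _ _ (seqsum k (fun s => (2 ^ k * d)%:R * \sum_(bm <- r) T bm s ^+ 2))).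
  apply: le_seqsum => s sk; rewrite -expr2 (ecoef_grad_dot _ _ qd) sk.
  have -> : \sum_(b <- bitmasks k) \sum_(m < d) (m`!%:R)^-1 * T (b, nat_of_ord m) s =
      \sum_(bm <- r) (bm.2`!%:R)^-1 * T bm s.
    rewrite big_allpairs; apply: eq_bigr => b _.
    by rewrite -[in RHS](subn0 d) -/(index_iota 0 d) big_mkord.
  apply: (le_trans (sqr_sum_le _ _)); rewrite sr ler_wpM2l//.
  apply: ler_sum => bm _; rewrite exprMn ler_piMl ?sqr_ge0// exprn_ile1// ?invr_ge0//.
  by rewrite invf_le1 ?ler1n ?ltr0n ?fact_gt0.
rewrite seqsumZ seqsum_sum expr2 -mulrA ler_wpM2l//.
have <- : \sum_(bm <- r) L * B = (2 ^ k * d)%:R * (L * B).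
  by rewrite big_const_seq count_predT iter_addr addr0 sr mulr_natl.
rewrite big_seq [leRHS]big_seq; apply: ler_sum => -[b m] /allpairsP[[b' m'] /= [bk _ [-> _]]].
have bk' := mem_bitmasks bk.
rewrite -bk'; apply: (seqsum_contraction (f := ecoef p) (g := ecoef q) (m := m.+1)) => //.
by rewrite bk'.
Qed.

(** The term of order 0 in Parseval's identity is the squared mean. Only positive orders remain,
    where masks are non-empty and contractions are small. *)
Lemma variance_grad_dot d p q (L B : R) :
  0 <= L -> 0 <= B ->
  (forall s, (d < size s)%N -> ecoef p s = 0) ->
  (forall s, (d < size s)%N -> ecoef q s = 0) ->
  contracts (ecoef p) L -> contracts (ecoef q) L ->
  (forall m, seqsum m (fun s => ecoef p s ^+ 2) <= B) ->
  (forall m, seqsum m (fun s => ecoef q s ^+ 2) <= B) ->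
  E (grad_dot p q * grad_dot p q) - E (grad_dot p q) ^+ 2 <= (d.*2 * (2 ^ d.*2 * d) ^ 2)%:R * (L * B).
Proof.
move=> L0 B0 pd qd cp cq pB qB; set y := grad_dot p q.
rewrite (parseval E1 Eibp (M := d.*2.+1)); last first.
  by move=> s ds; apply: (ecoef_grad_dot_eq0 pd qd); rewrite ltnW.
rewrite big_ord_recl /= invr1 mul1r {1}/ecoef_dot /= -expr2 addrAC subrr add0r.
apply: (@le_trans _ _ (\sum_(i < d.*2) ((2 ^ d.*2 * d)%:R) ^+ 2 * (L * B))).
  apply: ler_sum => k _; rewrite /bump add1n.
  apply: (@le_trans _ _ (ecoef_dot E k.+1 y y)).
    rewrite ler_piMl//; last by rewrite invf_le1 ?ler1n ?ltr0n ?fact_gt0.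
    by apply: seqsum_ge0 => s; rewrite -expr2 sqr_ge0.
  apply: (le_trans (ecoef_grad_dot_norm _ L0 qd cp cq pB qB)) => //.
  rewrite ler_wpM2r ?mulr_ge0// -!natrX ler_nat leq_exp2r// leq_mul2r leq_exp2l//.
  by rewrite ltn_ord orbT.
by rewrite sumr_const card_ord (natrM _ d.*2) natrX -mulrA mulr_natl.
Qed.

End GradientDot.

(** * Chaos decompositions and eigenvalues *)

(** The recurrence q H_q = t H_(q-1) - H_(q-2), stated in any algebra: over [R^o] it gives the
    function H_q, over [mpoly] the polynomial H_q(<h, x>). *)
Fixpoint herm (R : realType) (A : algType R) (l : A) (q : nat) : A :=
  match q with
  | 0 => 1
  | 1 => l
  | (q''.+1 as q').+1 => (q%:R : R)^-1 *: (l * herm l q' - herm l q'')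
  end.

Arguments herm : simpl never.

Section Hermite.
Context {R : realType}.

Lemma herm0 (A : algType R) (l : A) : herm l 0 = 1. Proof. by []. Qed.

Lemma herm1 (A : algType R) (l : A) : herm l 1 = l. Proof. by []. Qed.

Lemma hermE (A : algType R) (l : A) q :
  herm l q.+2 = q.+2%:R^-1 *: (l * herm l q.+1 - herm l q).
Proof. by []. Qed.

Lemma hermSS (A : algType R) (l : A) q :
  q.+2%:R *: herm l q.+2 = l * herm l q.+1 - herm l q.
Proof. by rewrite hermE scalerA divff ?scale1r. Qed.

Local Notation hermR q := (fun t : R => herm (t : R^o) q : R).

Lemma hermRS q (t : R) :
  q.+1%:R * hermR q.+1 t = t * hermR q t - (if q is q'.+1 then hermR q' t else 0).
Proof.
case: q => [|q]; first by rewrite herm1 herm0 mulr1 subr0 mul1r.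
by rewrite -[LHS]/(_ *: _) hermSS.
Qed.

Lemma is_derive_herm q (t : R) :
  is_derive t 1 (hermR q) (if q is q'.+1 then hermR q' t else 0).
Proof.
suff [] : is_derive t 1 (hermR q) (if q is q'.+1 then hermR q' t else 0) /\
  is_derive t 1 (hermR q.+1) (hermR q t) by [].
elim: q => [|q [IH1 IH2]].
  by split; [exact: is_derive_cst | exact: is_derive_id].
split=> //.
have -> : hermR q.+2 = (q.+2%:R : R)^-1 \*: (id \* hermR q.+1 - hermR q) :> (R -> R).
  by apply/funext.
apply: is_derive_eq.
rewrite -![_ *: _]/(_ * _) mulr1 addrAC -hermRS.
by rewrite -{2}(mul1r (hermR q.+1 t)) -mulrDl natr1 mulrA mulVf ?mul1r.
Qed.

(** Rodrigues' formula. Differentiating the right-hand side uses H_q' = H_(q-1) and the recurrence,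
    and matches the normalization of the statement. *)
Lemma derive1n_gauss q (t : R) :
  derive1n q (fun s : R => expR (- (s ^+ 2 / 2))) t =
  (-1) ^+ q * q`!%:R * hermR q t * expR (- (t ^+ 2 / 2)).
Proof.
elim: q t => [|q IH] t.
  by rewrite /= expr0 fact0 !mul1r.
rewrite derive1nS derive1E.
pose f : R -> R :=
  (((-1) ^+ q * q`!%:R) \*: hermR q) * (expR \o (- (2^-1 \*: (@GRing.exp R ^~ 2)))).
have -> : derive1n q (fun s : R => expR (- (s ^+ 2 / 2))) = f.
  apply/funext => s; rewrite IH; congr (_ * expR _); congr (- _).
  by rewrite mulrC.
have dH := is_derive_herm q t.
suff df : is_derive t 1 f
    ((-1) ^+ q.+1 * (q.+1)`!%:R * hermR q.+1 t * expR (- (t ^+ 2 / 2))).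
  by rewrite derive_val.
rewrite /f; apply: is_derive_eq.
set c := (if q is q'.+1 then hermR q' t else 0).
change (((-1) ^+ q * q`!%:R * hermR q t) *
    (expR (- (2^-1 * t ^+ 2)) * - (2^-1 * (t * 1 + t * 1))) +
  expR (- (2^-1 * t ^+ 2)) * (((-1) ^+ q * q`!%:R) * c) =
  (-1) ^+ q.+1 * (q.+1)`!%:R * hermR q.+1 t * expR (- (t ^+ 2 / 2))).
have -> : 2^-1 * (t * 1 + t * 1) = t by field.
rewrite (mulrC 2^-1) factS natrM (exprS (-1)).
set e := expR _; set z := (-1) ^+ q.
have hr : q.+1%:R * hermR q.+1 t = t * hermR q t - c := hermRS q t.
move: (hermR q.+1 t) (hermR q t) hr => H1 H hr.
transitivity (- (z * q`!%:R * e * (t * H - c))); first by ring.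
by rewrite -hr; ring.
Qed.

Lemma hermiteE q (t : R) : hermite q t = hermR q t.
Proof.
rewrite /hermite derive1n_gauss.
have q0 : (q`!%:R : R) != 0 by rewrite pnatr_eq0 -lt0n fact_gt0.
rewrite expRN.
set e := expR _; have e0 : e != 0 by rewrite gt_eqF ?expR_gt0.
rewrite -[X in X = _]mulrA; set z := (-1) ^+ q.
have zz : z * z = 1 by rewrite -expr2 /z -exprM mulnC exprM sqrrN expr1n expr1n.
transitivity ((z * z) * (q`!%:R^-1 * q`!%:R) * (e * e^-1) * hermR q t); first by ring.
by rewrite zz mulVf// divff// !mul1r.
Qed.

End Hermite.

Section HermitePoly.
Context {R : realType} {n : nat}.
Local Notation poly := (mpoly n R).
Local Notation var i := (mpolyX R (mnm1 i)).
Implicit Types (p r : poly) (h : 'I_n -> R).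

Definition linform h : poly := \sum_(j < n) h j *: var j.

Lemma meval_herm (v : 'I_n -> R) (l : poly) q :
  meval v (herm l q) = herm (meval v l : R^o) q.
Proof.
suff [] : meval v (herm l q) = herm (meval v l : R^o) q /\
  meval v (herm l q.+1) = herm (meval v l : R^o) q.+1 by [].
elim: q => [|q [IH1 IH2]]; first by rewrite herm0 herm1 meval1.
by split=> //; rewrite !hermE mevalZ mevalB mevalM IH1 IH2.
Qed.

Lemma meval_linform (v : 'I_n -> R) h : meval v (linform h) = \sum_(j < n) h j * v j.
Proof.
rewrite /linform linear_sum; apply: eq_bigr => j _.
by rewrite /= mevalZ mevalXU.
Qed.

Lemma mderiv_linform j h : mderiv j (linform h) = h j *: 1.
Proof.
rewrite /linform linear_sum (bigD1 j) //= linearZ /= mderiv_var eqxx big1 ?addr0//.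
by move=> k kj; rewrite linearZ /= mderiv_var eq_sym (negPf kj) scaler0.
Qed.

Lemma mderiv_herm j h q :
  mderiv j (herm (linform h) q) = if q is q'.+1 then h j *: herm (linform h) q' else 0.
Proof.
set l := linform h.
suff [] : mderiv j (herm l q) = (if q is q'.+1 then h j *: herm l q' else 0) /\
  mderiv j (herm l q.+1) = h j *: herm l q by [].
elim: q => [|q [IH1 IH2]].
  by rewrite herm0 herm1 -mpolyC1 mderivC mderiv_linform.
split=> //; rewrite hermE linearZ linearB /= mderivM IH1.
rewrite mderiv_linform -scalerAl mul1r.
have e : l * mderiv j (herm l q.+1) - (if q is q'.+1 then h j *: herm l q' else 0) =
   h j *: (q.+1%:R *: herm l q.+1).
  case: q IH1 IH2 => [|q] IH1 IH2; first by rewrite IH2 herm0 herm1 subr0 scale1r -scalerAr mulr1.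
  by rewrite IH2 -scalerAr -scalerBr -hermSS.
rewrite -addrA e -scalerDr scalerA mulrC -scalerA; congr (_ *: _).
by rewrite -{1}(scale1r (herm l q.+1)) -scalerDl scalerA addrC natr1 mulVf ?scale1r.
Qed.

Lemma dseq_herm h q s : dseq s (herm (linform h) q) =
  if (size s <= q)%N then (\prod_(j <- s) h j) *: herm (linform h) (q - size s) else 0.
Proof.
elim: s q => [|j s IH] q; first by rewrite /= big_nil scale1r subn0.
rewrite /= mderiv_herm; case: q => [|q]; first by rewrite linear0.
rewrite linearZ /= IH ltnS subSS big_cons.
by case: ifP; rewrite ?scaler0// scalerA.
Qed.

(* Minus the Ornstein-Uhlenbeck generator; it multiplies W^q by q. *)
Definition numop p : poly := \sum_(j < n) (var j * mderiv j p - mderiv j (mderiv j p)).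

Lemma numop_is_linear : linear numop.
Proof.
move=> c p r; rewrite /numop scaler_sumr -big_split /=; apply: eq_bigr => j _.
rewrite linearP /= linearP /= mulrDr -scalerAr scalerBr opprD.
by rewrite -!addrA; congr (_ + _); rewrite addrCA.
Qed.
HB.instance Definition _ := GRing.isLinear.Build R poly poly _ numop numop_is_linear.

(** The first-order terms sum to <h, x> H_(q-1) and the second-order ones to |h|^2 H_(q-2); for a
    unit vector their difference is the recurrence. *)
Lemma numop_herm h q : \sum_(j < n) h j ^+ 2 = 1 ->
  numop (herm (linform h) q) = q%:R *: herm (linform h) q.
Proof.
move=> h1; rewrite /numop.
case: q => [|[|q]].
- by rewrite big1 ?scale0r// => j _; rewrite mderiv_herm mulr0 linear0 subr0.
- rewrite scale1r [RHS]herm1; apply: eq_bigr => j _.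
  by rewrite mderiv_herm linearZ /= mderiv_herm scaler0 subr0 -scalerAr mulr1.
rewrite hermSS sumrB; congr (_ - _).
  rewrite /linform mulr_suml; apply: eq_bigr => j _.
  by rewrite mderiv_herm -scalerAr scalerAl.
rewrite -[RHS]scale1r -h1 scaler_suml; apply: eq_bigr => j _.
by rewrite mderiv_herm linearZ /= mderiv_herm scalerA expr2.
Qed.

Context (E : {scalar poly}).
Hypothesis E1 : E 1 = 1.
Hypothesis Eibp : forall j p, E (var j * p) = E (mderiv j p).

(** The Dirichlet form of the number operator: integrating x_j by parts produces a second derivative
    that cancels the one in [numop]. *)
Lemma numop_ibp p r : E (numop p * r) = E (grad_dot p r).
Proof.
rewrite /numop /grad_dot mulr_suml !linear_sum /=; apply: eq_bigr => j _.
by rewrite mulrBl linearB /= -mulrA Eibp mderivM linearD /= addrAC subrr add0r.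
Qed.

(** Testing [numop_ibp] against 1 shows that [numop] has mean zero values; at q > 0 the eigenvalue q
    can be divided out. *)
Lemma E_herm h q : \sum_(j < n) h j ^+ 2 = 1 -> E (herm (linform h) q) = (q == 0%N)%:R.
Proof.
move=> h1; case: q => [|q]; first by rewrite herm0 E1.
have := numop_ibp (herm (linform h) q.+1) 1.
rewrite numop_herm// mulr1 linearZ /= /grad_dot big1 ?linear0 => [|j _].
  by move=> /eqP; rewrite mulf_eq0 pnatr_eq0 /= => /eqP.
by rewrite -mpolyC1 mderivC mulr0.
Qed.

Lemma ecoef_herm h q s : \sum_(j < n) h j ^+ 2 = 1 ->
  ecoef E (herm (linform h) q) s = (size s == q)%:R * \prod_(j <- s) h j.
Proof.
move=> h1; rewrite /ecoef dseq_herm.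
case: (ltngtP (size s) q) => sq.
- by rewrite linearZ /= E_herm// subn_eq0 leqNgt sq mulr0 mul0r.
- by rewrite linear0 mul0r.
- by rewrite linearZ /= E_herm// sq subnn eqxx mulr1 mul1r.
Qed.

(** All that is used of I_q(f) later. The coefficients at orders other than [q] vanish because d_s
    H_q is a multiple of H_(q - |s|), of mean zero unless |s| = q. Constants are singled out since
    [numop] kills them. *)
Lemma chaos_mpoly q (f : tensor R n 'I_q) P : is_chaos f P ->
  exists p : poly, [/\ forall x, peval p x = P x,
    forall i : {ffun 'I_q -> 'I_n}, ecoef E p (codom i) = q`!%:R * f i,
    forall s, size s != q -> ecoef E p s = 0,
    numop p = q%:R *: p &
    q = 0%N -> exists c : R, p = c *: 1].
Proof.
rewrite /is_chaos; case: eqP => [q0|qN0].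
  subst q => -[c [fc Pc]]; exists (c *: 1); split.
  - by move=> x; rewrite Pc /peval mevalZ meval1 mulr1.
  - move=> i; rewrite codomE enum_ord0 /ecoef /= linearZ /= E1 mulr1 fc.
    by rewrite mul1r.
  - case=> // j s _; rewrite /ecoef /= linearZ /= -mpolyC1 mderivC scaler0.
    by rewrite !linear0.
  - rewrite scale0r linearZ /= -[1]/(herm (linform (fun=> 0)) 0) /numop big1 ?scaler0// => j _.
    by rewrite mderiv_herm linear0 mulr0 subr0.
  - by move=> _; exists c.
move=> [m [c [h [h1 fE PE]]]].
exists (\sum_(k < m) c k *: (q`!%:R *: herm (linform (h k)) q)); split.
- move=> x; rewrite PE /peval linear_sum /=; apply: eq_bigr => k _.
  by rewrite !mevalZ meval_herm hermiteE meval_linform.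
- move=> i; rewrite fE /ecoef !linear_sum mulr_sumr; apply: eq_bigr => k _.
  rewrite !linearZ /= -/(ecoef _ _ _) ecoef_herm// mulrCA; congr (_ * (_ * _)).
  by rewrite size_codom card_ord eqxx mul1r codomE big_map big_enum.
- move=> s sq; rewrite /ecoef !linear_sum big1// => k _.
  by rewrite !linearZ /= -/(ecoef _ _ _) ecoef_herm// (negPf sq) mul0r !mulr0.
- rewrite linear_sum scaler_sumr; apply: eq_bigr => k _.
  by rewrite !linearZ /= numop_herm// !scalerA mulrC !mulrA; congr (_ *: _); ring.
- by [].
Qed.

End HermitePoly.

(** * Eigenvalues as operator norms of flattenings *)

Section Eigenvalues.
Context {R : realType} {n : nat}.
Implicit Types (f x y : seq 'I_n -> R).

Lemma seqsum_codom (J : finType) f :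
  \sum_(i : {ffun J -> 'I_n}) f (codom i) = seqsum #|J| f.
Proof.
rewrite seqsum_ffun.
pose h (i : {ffun 'I_#|J| -> 'I_n}) : {ffun J -> 'I_n} := [ffun j => i (enum_rank j)].
pose h' (i : {ffun J -> 'I_n}) : {ffun 'I_#|J| -> 'I_n} := [ffun j => i (enum_val j)].
rewrite (reindex h); last first.
  by exists h' => i _; apply/ffunP => j; rewrite !ffunE ?enum_valK ?enum_rankK.
apply: eq_bigr => i _; congr f; rewrite !codomE.
have -> : enum J = [seq enum_val j | j <- enum 'I_#|J|].
  rewrite -[LHS](map_tnth_enum (enum_tuple J)).
  by apply/eq_in_map => j _; apply: set_nth_default; rewrite -cardE.
by rewrite -map_comp; apply: eq_map => j /=; rewrite ffunE enum_valK.
Qed.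

Section TensorNorm.
Variables (J : finType) (x : tensor R n J).

Lemma tensor_norm_ge i : `|x i| <= tensor_norm x.
Proof.
rewrite -sqrtr_sqr ler_wsqrtr// /tensor_dot (bigD1 i) //= -expr2 lerDl.
by apply: sumr_ge0 => j _; rewrite -expr2 sqr_ge0.
Qed.

Lemma tensor_norm_gt0 : x <> [ffun=> 0] -> 0 < tensor_norm x.
Proof.
move=> x0; rewrite lt0r sqrtr_ge0 andbT; apply: contra_notN x0 => /eqP nx0.
apply/ffunP => i; rewrite ffunE; apply/eqP.
by rewrite -normr_le0 (le_trans (tensor_norm_ge i))// nx0.
Qed.

End TensorNorm.

Lemma lambda_part_ge p (g : tensor R n 'I_p) (S : {set 'I_p})
    (x : tensor R n {j | j \in S}) (y : tensor R n {j | j \in ~: S}) :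
  tensor_dot g (tensor_prod x y) <= lambda_part g S * (tensor_norm x * tensor_norm y).
Proof.
have dot0 : x = [ffun=> 0] \/ y = [ffun=> 0] ->
    tensor_dot g (tensor_prod x y) = 0 /\ tensor_norm x * tensor_norm y = 0.
  have norm0 J : tensor_norm ([ffun=> 0] : tensor R n J) = 0.
    by rewrite /tensor_norm /tensor_dot big1 ?sqrtr0// => i _; rewrite ffunE mul0r.
  by case=> ->; rewrite norm0 ?mul0r ?mulr0; split=> //; apply: big1 => i _;
    rewrite !ffunE ?mul0r ?mulr0.
have [/dot0[-> ->]|xy0] := pselect (x = [ffun=> 0] \/ y = [ffun=> 0]).
  by rewrite mulr0.
have {dot0} [x0 y0] : x <> [ffun=> 0] /\ y <> [ffun=> 0].
  by split=> e; apply: xy0; [left|right].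
have nx := tensor_norm_gt0 x0; have ny := tensor_norm_gt0 y0.
rewrite -ler_pdivrMr ?mulr_gt0//; apply: ub_le_sup; last by exists x, y.
(* The supremum dominates its elements only if it is finite. Entries of a tensor are at most its
   norm, so the l1-norm of [g] is an upper bound. *)
exists (\sum_i `|g i|) => _ [x' [y' [x'0 y'0 ->]]].
have nx' := tensor_norm_gt0 x'0; have ny' := tensor_norm_gt0 y'0.
rewrite ler_pdivrMr ?mulr_gt0// mulr_suml; apply: ler_sum => i _.
rewrite !ffunE (le_trans (ler_norm _))// !normrM ler_wpM2l//.
by rewrite ler_pM// tensor_norm_ge.
Qed.

(** A subtype is enumerated in the order of its type, so the word of a sub-index is a subword of
    that of the index. *)
Lemma val_enum_sig (T : finType) (P : pred T) :
  [seq val j | j <- enum {: {j | P j}}] = [seq j <- enum T | P j].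
Proof.
have e : Finite.enum {j | P j} =
    pmap (insub : T -> option {j | P j}) (Finite.enum T).
  by rewrite {1}Finite.enum.unlock.
transitivity [seq val j | j <- pmap (insub : T -> option {j | P j}) (Finite.enum T)].
  by rewrite enumT; exact: (congr1 (map val) e).
rewrite pmap_filter; last exact: insubK.
by rewrite enumT; apply: eq_filter => j; apply: isSome_insub.
Qed.

(** The partition is S = the first [m] positions against the rest; restricting an index to these
    sets amounts to [take m] and [drop m] on its word. *)
Lemma lambda_max_cat m a (g : tensor R n 'I_(m + a)) f x y :
  (0 < m)%N -> (0 < a)%N ->
  (forall i : {ffun 'I_(m + a) -> 'I_n}, f (codom i) = g i) ->
  seqsum m (fun l => seqsum a (fun u => f (l ++ u) * (x l * y u))) <=
  lambda_max g * (Num.sqrt (seqsum m (fun l => x l ^+ 2)) *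
                  Num.sqrt (seqsum a (fun u => y u ^+ 2))).
Proof.
move=> m0 a0 fg.
pose S : {set 'I_(m + a)} := [set j : 'I_(m + a) | (j < m)%N]%SET.
pose X : tensor R n {j | j \in S} := [ffun i : {ffun _ -> 'I_n} => x (codom i)].
pose Y : tensor R n {j | j \in (~: S)%SET} := [ffun i : {ffun _ -> 'I_n} => y (codom i)].
have enumS (T : {set 'I_(m + a)}) : [seq val j | j <- enum {: {j | j \in T}}] =
    [seq j <- enum 'I_(m + a) | j \in T].
  exact: val_enum_sig.
have fS : [seq j <- enum 'I_(m + a) | j \in S] = take m (enum 'I_(m + a)).
  apply: (inj_map val_inj); rewrite map_take val_enum_ord take_iota (minn_idPl (leq_addr a m)).
  under eq_filter => j do rewrite inE -[(j < m)%N]/(preim val (ltn^~ m) j).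
  by rewrite -filter_map val_enum_ord (@filter_iota_ltn 0) ?leq_addr.
have fSC : [seq j <- enum 'I_(m + a) | j \in (~: S)%SET] = drop m (enum 'I_(m + a)).
  apply: (inj_map val_inj); rewrite map_drop val_enum_ord drop_iota addKn.
  under eq_filter => j do rewrite !inE -[~~ (j < m)%N]/(preim val (fun k => ~~ (k < m)%N) j).
  rewrite -filter_map val_enum_ord iotaD filter_cat add0n.
  rewrite (@eq_in_filter _ _ pred0) ?filter_pred0//; last first.
    by move=> j; rewrite mem_iota => /andP[_ ->].
  by apply/all_filterP/allP => j; rewrite mem_iota -leqNgt => /andP[].
have sub (T : {set 'I_(m + a)}) (i : {ffun 'I_(m + a) -> 'I_n}) : codom (subindex T i) =
    [seq i j | j <- [seq j <- enum 'I_(m + a) | j \in T]].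
  have -> : (subindex T i : _ -> _) = i \o val by apply/funext => j; rewrite ffunE.
  by rewrite -enumS -map_comp codomE.
have cS : #|{: {j | j \in S}}| = m.
  by rewrite cardE -(size_map val) enumS fS size_takel// size_enum_ord leq_addr.
have cSC : #|{: {j | j \in (~: S)%SET}}| = a.
  by rewrite cardE -(size_map val) enumS fSC size_drop size_enum_ord addKn.
have nX : seqsum m (fun l => x l ^+ 2) = tensor_dot X X.
  rewrite -[in LHS]cS -seqsum_codom; apply: eq_bigr => i _.
  by rewrite ffunE expr2.
have nY : seqsum a (fun l => y l ^+ 2) = tensor_dot Y Y.
  rewrite -[in LHS]cSC -seqsum_codom; apply: eq_bigr => i _.
  by rewrite ffunE expr2.
rewrite nX nY -/(tensor_norm X) -/(tensor_norm Y).
have -> : seqsum m (fun l => seqsum a (fun u => f (l ++ u) * (x l * y u))) =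
    tensor_dot g (tensor_prod X Y).
  transitivity (seqsum (m + a) (fun s => f s * (x (take m s) * y (drop m s)))).
    rewrite seqsum_cat; apply: eq_seqsum => l lm; apply: eq_seqsum => u _.
    by rewrite take_size_cat// drop_size_cat.
  rewrite seqsum_ffun; apply: eq_bigr => i _.
  by rewrite fg !ffunE !sub fS fSC map_take map_drop -codomE.
apply: (le_trans (lambda_part_ge _ _ _)); rewrite ler_wpM2r ?mulr_ge0 ?sqrtr_ge0//.
apply: le_bigmax_cond; apply/andP; split; apply/set0Pn.
  by exists (Ordinal (leq_trans m0 (leq_addr a m))); rewrite inE.
have h : (m < m + a)%N by rewrite -addn1 leq_add2l.
by exists (Ordinal h); rewrite !inE /= ltnn.
Qed.

End Eigenvalues.

Section ChaosBounds.
Context {R : realType} {n : nat}.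
Local Notation poly := (mpoly n R).
Local Notation var i := (mpolyX R (mnm1 i)).
Implicit Types p : poly.
Context (E : {scalar poly}).
Hypothesis E1 : E 1 = 1.
Hypothesis Eibp : forall j p, E (var j * p) = E (mderiv j p).
Local Notation ecoef := (ecoef E).

Lemma chaos_polynomials d (F : poly) (f : forall q, tensor R n 'I_q) :
  chaos_decomposition d F f ->
  exists p u, [/\ forall x, peval p x = peval F x,
    forall q (i : {ffun 'I_q -> 'I_n}), (q <= d)%N -> ecoef p (codom i) = q`!%:R * f q i,
    forall s, (d < size s)%N -> ecoef p s = 0,
    forall s, ecoef u s = (size s)%:R^-1 * ecoef p s &
    exists c : R, p = numop u + c *: 1].
Proof.
move=> [P [fP FP]].
have /choice[p pE] q : exists p : poly, (q <= d)%N ->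
    [/\ forall x, peval p x = P q x,
        forall i : {ffun 'I_q -> 'I_n}, ecoef p (codom i) = q`!%:R * f q i,
        forall s, size s != q -> ecoef p s = 0,
        numop p = q%:R *: p &
        q = 0%N -> exists c : R, p = c *: 1].
  have [qd|] := leqP q d; last by exists 0.
  have [p ?] := chaos_mpoly E1 Eibp (fP q qd).2.
  by exists p.
have coef (c : nat -> R) s : ecoef (\sum_(q < d.+1) c q *: p q) s =
    if (size s <= d)%N then c (size s) * ecoef (p (size s)) s else 0.
  rewrite /ecoef !linear_sum; case: leqP => sd.
    rewrite (bigD1 (Ordinal (sd : (size s < d.+1)%N))) //= !linearZ /=.
    rewrite big1 ?addr0// => q qs; rewrite !linearZ /=.
    have [_ _ h _ _] := pE q (ltn_ord q).
    by rewrite -/(ecoef (p q) s) h ?mulr0// eq_sym.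
  rewrite big1// => q _; rewrite !linearZ /=.
  have [_ _ h _ _] := pE q (ltn_ord q).
  by rewrite -/(ecoef (p q) s) h ?mulr0// gtn_eqF// (leq_trans _ sd).
(* As 0^-1 = 0, the second sum drops the constant component, which [numop] could not restore; it
   reappears as [c]. *)
exists (\sum_(q < d.+1) 1 *: p q), (\sum_(q < d.+1) q%:R^-1 *: p q); split.
- move=> x; rewrite FP /peval linear_sum; apply: eq_bigr => q _ /=.
  by rewrite scale1r; have [<- _ _ _ _] := pE q (ltn_ord q).
- move=> q i qd; rewrite (coef (fun=> 1)) size_codom card_ord qd mul1r.
  by have [_ -> _ _ _] := pE q qd.
- by move=> s ds; rewrite (coef (fun=> 1)) leqNgt ds.
- move=> s; rewrite (coef (fun=> 1)) (coef (fun q => q%:R^-1)).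
  by case: ifP; rewrite ?mulr0 ?mul1r.
- have [_ _ _ _ /(_ erefl)[c pc]] := pE 0%N (leq0n d).
  exists c; rewrite linear_sum !big_ord_recl /= !scale1r pc addrC; congr (_ + _).
  rewrite linearZ /= invr0 scale0r add0r; apply: eq_bigr => q _.
  rewrite linearZ /=; have [_ _ _ -> _] := pE (bump 0 q) (ltn_ord (lift ord0 q)).
  by rewrite scalerA mulVf ?scale1r ?pnatr_eq0.
Qed.

(** Up to the factor q! this is one of the nonnegative terms of Parseval's sum for E[p^2]. *)
Lemma ecoef_norm_le d p q : (forall s, (d < size s)%N -> ecoef p s = 0) ->
  seqsum q (fun s => ecoef p s ^+ 2) <= d`!%:R * E (p * p).
Proof.
move=> pd.
have V0 : 0 <= E (p * p).
  rewrite (parseval E1 Eibp (M := d.+1))//; apply: sumr_ge0 => k _.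
  by rewrite mulr_ge0 ?invr_ge0// seqsum_ge0// => s; rewrite -expr2 sqr_ge0.
have [qd|qd] := ltnP q d.+1; last first.
  by rewrite seqsum0 ?mulr_ge0// => s sq; rewrite pd ?expr0n// sq.
apply: (@le_trans _ _ (q`!%:R * E (p * p))).
  rewrite (parseval E1 Eibp (M := d.+1))// (bigD1 (Ordinal qd)) //= mulrDr.
  rewrite mulrA divff ?mul1r ?pnatr_eq0 -?lt0n ?fact_gt0//.
  apply: ler_wpDr; last first.
    by apply: le_seqsum => s _; rewrite expr2.
  rewrite mulr_ge0// sumr_ge0// => k _.
  by rewrite mulr_ge0 ?invr_ge0// seqsum_ge0// => s; rewrite -expr2 sqr_ge0.
by rewrite ler_wpM2r// ler_nat leq_fact.
Qed.

(** The operator norm is at most the Hilbert-Schmidt norm. *)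
Lemma contracts_cauchy_schwarz (f : seq 'I_n -> R) (B : R) :
  (forall q, seqsum q (fun s => f s ^+ 2) <= B) -> contracts f B.
Proof.
move=> fB m a x m0 a0.
apply: (@le_trans _ _ (seqsum a (fun u => seqsum m (fun l => f (l ++ u) ^+ 2) *
    seqsum m (fun l => x l ^+ 2)))).
  by apply: le_seqsum => u _; exact: seqsum_cauchy_schwarz.
under eq_seqsum => u _ do rewrite mulrC.
rewrite seqsumZ mulrC seqsum_exchange -(seqsum_cat _ _ (fun s => f s ^+ 2)).
by rewrite ler_wpM2r// seqsum_ge0// => s; rewrite sqr_ge0.
Qed.

Lemma contracts_lambda_max d p (f : forall q, tensor R n 'I_q) (lam : R) :
  0 <= lam ->
  (forall q (i : {ffun 'I_q -> 'I_n}), (q <= d)%N -> ecoef p (codom i) = q`!%:R * f q i) ->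
  (forall s, (d < size s)%N -> ecoef p s = 0) ->
  (forall q, (2 <= q <= d)%N -> lambda_max (f q) <= lam) ->
  contracts (ecoef p) ((d`!%:R * lam) ^+ 2).
Proof.
move=> lam0 pf pd flam m a x m0 a0.
have x0 : 0 <= seqsum m (fun l => x l ^+ 2) by apply: seqsum_ge0 => s; rewrite sqr_ge0.
have [qd|qd] := leqP (m + a) d; last first.
  rewrite seqsum0 ?mulr_ge0 ?sqr_ge0// => u ua.
  by rewrite seqsum0 ?expr0n// => l lm; rewrite pd ?mul0r// size_cat lm ua.
pose w : R := (m + a)`!%:R; have w0 : 0 < w by rewrite ltr0n fact_gt0.
(* The eigenvalue bounds a bilinear form. Pairing with the image [y] of [x] itself gives |y|^2 <=
   lam |x| |y|, hence the operator bound. *)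
pose g s := w^-1 * ecoef p s; pose y u := seqsum m (fun l => g (l ++ u) * x l).
have lamq : lambda_max (f (m + a)%N) <= lam by apply: flam; rewrite qd andbT (leq_add m0 a0).
have := @lambda_max_cat _ _ m a (f (m + a)%N) g x y m0 a0.
have -> : seqsum m (fun l => seqsum a (fun u => g (l ++ u) * (x l * y u))) =
    seqsum a (fun u => y u ^+ 2).
  rewrite seqsum_exchange; apply: eq_seqsum => u _.
  by rewrite expr2 {2}/y -seqsumZ; apply: eq_seqsum => l _; rewrite mulrA mulrC.
set X := seqsum m _ in x0 *; set Y := seqsum a _.
have Y0 : 0 <= Y by apply: seqsum_ge0 => s; rewrite sqr_ge0.
move=> /(_ _)/wrap[|H]; first by move=> i; rewrite /g pf// mulrA mulVf ?mul1r// gt_eqF.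
have YX : Y <= lam ^+ 2 * X.
  have [->|Yn0] := eqVneq Y 0; first by rewrite mulr_ge0 ?sqr_ge0.
  have sY : 0 < Num.sqrt Y by rewrite sqrtr_gt0 lt0r Yn0.
  have : Num.sqrt Y <= lam * Num.sqrt X.
    rewrite -(ler_pM2r sY) -expr2 sqr_sqrtr// (le_trans H)// mulrA.
    by rewrite !ler_wpM2r// ?sqrtr_ge0.
  rewrite -(ler_pXn2r (n := 2))// ?nnegrE ?mulr_ge0 ?sqrtr_ge0//.
  by rewrite exprMn !sqr_sqrtr.
have -> : seqsum a (fun u => seqsum m (fun l => ecoef p (l ++ u) * x l) ^+ 2) = w ^+ 2 * Y.
  rewrite -seqsumZ; apply: eq_seqsum => u _; rewrite -exprMn -seqsumZ; congr (_ ^+ 2).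
  by apply: eq_seqsum => l _; rewrite /g !mulrA divff ?mul1r// gt_eqF.
rewrite exprMn -[leRHS]mulrA ler_pM ?sqr_ge0//.
by have w0' := ltW w0; rewrite ler_pXn2r ?nnegrE// ler_nat leq_fact.
Qed.

Lemma chaos_bounds d p (u : poly) (f : forall q, tensor R n 'I_q) (eps : R) :
  (forall q (i : {ffun 'I_q -> 'I_n}), (q <= d)%N -> ecoef p (codom i) = q`!%:R * f q i) ->
  (forall s, (d < size s)%N -> ecoef p s = 0) ->
  (forall s, ecoef u s = (size s)%:R^-1 * ecoef p s) ->
  E (p * p) <= 1 ->
  \big[Num.max/0]_(2 <= q < d.+1) lambda_max (f q) / Num.sqrt (E (p * p)) <= eps ->
  [/\ 0 <= eps,
   contracts (ecoef p) (d`!%:R ^+ 2 * eps), contracts (ecoef u) (d`!%:R ^+ 2 * eps),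
   forall q, seqsum q (fun s => ecoef p s ^+ 2) <= d`!%:R &
   forall q, seqsum q (fun s => ecoef u s ^+ 2) <= d`!%:R].
Proof.
move=> pf pd up V1 lameps.
set lam := \big[_/_]_(_ <= _ < _) _ in lameps.
have lam0 : 0 <= lam by apply: bigmax_ge_id.
have eps0 : 0 <= eps by rewrite (le_trans _ lameps)// divr_ge0// sqrtr_ge0.
have V0 : 0 <= E (p * p).
  have := ecoef_norm_le 0 pd; rewrite /= => h.
  by rewrite -(pmulr_rge0 _ (_ : 0 < d`!%:R)) ?ltr0n ?fact_gt0// (le_trans _ h)// sqr_ge0.
have d1 : 1 <= d`!%:R :> R by rewrite ler1n fact_gt0.
have normp q : seqsum q (fun s => ecoef p s ^+ 2) <= d`!%:R.
  by rewrite (le_trans (ecoef_norm_le q pd))// ler_piMr.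
have sizeV q : (q%:R^-1 : R) ^+ 2 <= 1.
  rewrite exprn_ile1// ?invr_ge0//; case: q => [|q]; first by rewrite invr0.
  by rewrite invf_le1 ?ler1n ?ltr0n.
have cp : contracts (ecoef p) (d`!%:R ^+ 2 * eps).
  (* If Var p = 0 or eps >= 1, Cauchy-Schwarz suffices; otherwise lambda_max^2
     <= eps^2 <= eps. *)
  have [Ve|Ve] := pselect (E (p * p) = 0 \/ 1 <= eps).
    have : contracts (ecoef p) (d`!%:R * E (p * p)).
      by apply: contracts_cauchy_schwarz => q; exact: ecoef_norm_le.
    move=> c m a x m0 a0; apply: (le_trans (c m a x m0 a0)).
    apply: ler_wpM2r; first by apply: seqsum_ge0 => s; rewrite sqr_ge0.
    rewrite expr2 -mulrA ler_wpM2l//.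
    case: Ve => [->|e1]; first by rewrite mulr_ge0.
    by rewrite (le_trans V1)// mulr_ege1.
  have {Ve} [Vn0 e1] : 0 < E (p * p) /\ eps < 1.
    split; last by rewrite ltNge; apply/negP => h; apply: Ve; right.
    by rewrite lt0r V0 andbT; apply/eqP => h; apply: Ve; left.
  have lame : lam <= eps.
    move: lameps; rewrite ler_pdivrMr ?sqrtr_gt0// => /le_trans; apply.
    by rewrite ler_piMr// -sqrtr1 ler_wsqrtr.
  have := contracts_lambda_max eps0 pf pd.
  move=> /(_ _)/wrap[q /andP[q2 qd]|c m a x m0 a0].
    rewrite (le_trans _ lame)//.
    apply: (@le_bigmax_seq _ _ _ (index_iota 2 d.+1) 0 q xpredT (fun q => lambda_max (f q))) => //.
    by rewrite mem_index_iota q2 ltnS.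
  apply: (le_trans (c m a x m0 a0)).
  apply: ler_wpM2r; first by apply: seqsum_ge0 => s; rewrite sqr_ge0.
  by rewrite exprMn ler_wpM2l ?sqr_ge0// expr2 ler_piMr// ltW.
split=> //.
(* A flattening of shape (m, a) sees only the order m + a, where the coefficients of [u] are those
   of [p] divided by m + a. *)
- move=> m a x m0 a0; apply: le_trans (cp m a x m0 a0); apply: le_seqsum => s sa.
  have -> : seqsum m (fun l => ecoef u (l ++ s) * x l) =
      (m + a)%:R^-1 * seqsum m (fun l => ecoef p (l ++ s) * x l).
    rewrite -seqsumZ; apply: eq_seqsum => l lm.
    by rewrite up size_cat lm sa mulrA.
  by rewrite exprMn ler_piMl ?sqr_ge0.
- move=> q; apply: le_trans (normp q); apply: le_seqsum => s _.
  by rewrite up exprMn ler_piMl ?sqr_ge0.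
Qed.

End ChaosBounds.

(** * Gaussian integration by parts *)

Section NormalMoments.
Context {R : realType}.
Local Notation mu := lebesgue_measure.
Local Notation N01 := (normal_prob (0 : R) 1).
Local Notation pdf := (normal_pdf (0 : R) 1).

(** The Radon-Nikodym derivative and the density have equal integrals over all measurable sets,
    hence agree almost everywhere. *)
Lemma ge0_integral_normal_prob (f : measurableTypeR R -> \bar R) :
  (forall x, (0 <= f x)%E) -> measurable_fun setT f ->
  (\int[N01]_x f x = \int[mu]_x (f x * (pdf x)%:E))%E.
Proof.
move=> f0 mf.
rewrite -(Radon_Nikodym_SigmaFinite.change_of_variables (normal_prob_dominates 0 1))//.
have intRN := Radon_Nikodym_SigmaFinite.f_integrable (normal_prob_dominates (0 : R) 1).
apply: ae_eq_integral => //.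
- by apply: emeasurable_funM => //; exact: (measurable_int mu).
- apply: emeasurable_funM => //; apply/measurable_EFinP; exact: measurable_normal_pdf.
- apply: ae_eqe_mul2l; apply: integral_ae_eq => //.
  + by apply/measurable_EFinP; exact: measurable_normal_pdf.
  + move=> A _ mA; rewrite -Radon_Nikodym_SigmaFinite.f_integral//.
    exact: normal_prob_dominates.
Qed.

Lemma integrable_normal_probP (f : measurableTypeR R -> R) : measurable_fun setT f ->
  N01.-integrable setT (EFin \o f) <-> mu.-integrable setT (fun x => (f x * pdf x)%:E).
Proof.
move=> mf.
have mpdf := @measurable_normal_pdf R 0 1.
have e : (\int[N01]_x `|(f x)%:E| = \int[mu]_x `|(f x * pdf x)%:E|)%E.
  rewrite ge0_integral_normal_prob//; last first.
    by apply/measurableT_comp => //; exact/measurable_EFinP.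
  apply: eq_integral => x _; rewrite EFinM abseM; congr (_ * _)%E.
  by rewrite /= ger0_norm// normal_pdf_ge0.
split=> /integrableP[_ h]; apply/integrableP; split.
- by apply/measurable_EFinP; exact: measurable_funM.
- by rewrite -e.
- exact/measurable_EFinP.
- by rewrite [X in (X < _)%E]e.
Qed.

Lemma integral_normal_prob (f : measurableTypeR R -> R) : measurable_fun setT f ->
  N01.-integrable setT (EFin \o f) ->
  (\int[N01]_x (f x)%:E = \int[mu]_x (f x * pdf x)%:E)%E.
Proof.
move=> mf intf; have mpdf := @measurable_normal_pdf R 0 1.
have mEf : measurable_fun setT (EFin \o f) by exact/measurable_EFinP.
rewrite integralE [RHS]integralE; congr (_ - _)%E.
- rewrite ge0_integral_normal_prob//; last exact: measurable_funepos.
  apply: eq_integral => x _; rewrite !funeposE /= EFinM.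
  by rewrite -!EFin_max -!EFinM maxr_pMl ?normal_pdf_ge0// mul0r.
- rewrite ge0_integral_normal_prob//; last exact: measurable_funeneg.
  apply: eq_integral => x _; rewrite !funenegE /=.
  by rewrite -!EFin_max -!EFinM maxr_pMl ?normal_pdf_ge0// mul0r mulNr.
Qed.

Lemma normal_pdf01E (t : R) : pdf t = pdf 0 * expR (- (t ^+ 2 / 2)).
Proof.
rewrite !normal_pdfE ?oner_eq0// /normal_fun !subr0 expr0n oppr0 mul0r expR0 mulr1.
by rewrite expr1n mulNr.
Qed.

(** Passing from variance 1 to variance 2 frees a factor exp(-t^2/4), which absorbs any power of 1 +
    t^2. Integrability and boundedness are thereby inherited from a normal density. *)
Lemma weight_pdf_le k : exists2 C : R, 0 <= C &
  forall t, (1 + t ^+ 2) ^+ k * pdf t <= C * normal_pdf 0 (Num.sqrt 2) t.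
Proof.
(* Chosen so that y / 4 = (k+1) (y / K): then y / K <= exp(y / K), raised to the power k+1, bounds
   y^(k+1) by K^(k+1) exp(y / 4). *)
pose K : R := 4 * k.+1%:R.
have K0 : 0 < K by rewrite mulr_gt0.
exists (K ^+ k.+1 * pdf 0 * expR 4^-1 / normal_peak (Num.sqrt 2)) => [|t].
  rewrite divr_ge0 ?normal_peak_ge0// ?mulr_ge0 ?expR_ge0 ?normal_pdf_ge0//.
  by rewrite exprn_ge0// ltW.
have s2 : Num.sqrt 2 != 0 :> R by rewrite gt_eqF// sqrtr_gt0.
rewrite (normal_pdfE _ s2) -[leRHS]mulrA [_^-1 * _]mulrA mulVf ?mul1r; last first.
  by rewrite gt_eqF// normal_peak_gt0.
rewrite normal_pdf01E /normal_fun subr0 sqr_sqrtr//.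
set y := 1 + t ^+ 2; have y1 : 1 <= y by rewrite lerDl sqr_ge0.
have yK : y ^+ k <= K ^+ k.+1 * expR (y / 4).
  have -> : y / 4 = k.+1%:R * (y / K) by rewrite /K; field.
  rewrite expRM_natl -exprMn (le_trans (_ : _ <= y ^+ k.+1))//.
    by rewrite exprS ler_peMl// exprn_ge0// (le_trans _ y1).
  rewrite lerXn2r ?nnegrE//.
  - by rewrite (le_trans _ y1).
  - by rewrite mulr_ge0 ?expR_ge0// ltW.
  rewrite mulrC -ler_pdivrMr//; apply: le_trans (expR_ge1Dx _).
  by rewrite lerDr.
set e := expR (- (t ^+ 2 / 2)); set e' := expR (- t ^+ 2 / _).
have -> : K ^+ k.+1 * pdf 0 * expR 4^-1 * e' =
  pdf 0 * (K ^+ k.+1 * (expR 4^-1 * e')) by ring.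
rewrite [leLHS]mulrCA ler_wpM2l ?normal_pdf_ge0//.
apply: (@le_trans _ _ (K ^+ k.+1 * expR (y / 4) * e)).
  by rewrite ler_wpM2r// expR_ge0.
rewrite -[leLHS]mulrA /e /e' -!expRD ler_wpM2l ?exprn_ge0 ?(ltW K0)// ler_expR /y.
rewrite le_eqVlt; apply/orP; left; apply/eqP.
by rewrite -[2 *+ 2]mulr_natr; field.
Qed.

Lemma integrable_weight k :
  N01.-integrable setT (fun t : measurableTypeR R => ((1 + t ^+ 2) ^+ k)%:E).
Proof.
have mw : measurable_fun [set: measurableTypeR R] (fun t : R => (1 + t ^+ 2) ^+ k).
  by apply/measurable_funX/measurable_funD => //; exact: measurable_funX.
have mpdf := @measurable_normal_pdf R 0 1.
apply/(integrable_normal_probP mw).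
have [C C0 Cle] := weight_pdf_le k.
apply: (@le_integrable _ _ R mu setT measurableT _
  (fun t : measurableTypeR R => (C * normal_pdf 0 (Num.sqrt 2) t)%:E)) => //.
- by apply/measurable_EFinP; exact: measurable_funM.
- move=> t _; rewrite /= lee_fin ger0_norm ?(le_trans (Cle t)) ?ler_norm//.
  by rewrite mulr_ge0 ?normal_pdf_ge0// exprn_ge0// addr_ge0// sqr_ge0.
- rewrite /=; under eq_fun do rewrite EFinM.
  by apply: integrableZl => //; exact: integrable_normal_pdf.
Qed.

Lemma normr_le_weight (t : R) : `|t| <= 1 + t ^+ 2.
Proof.
have := sqr_ge0 (`|t| - 1); rewrite sqrrB1 real_normK ?num_real//.
have := normr_ge0 t; lra.
Qed.

Lemma weight_ge1 (t : R) : 1 <= 1 + t ^+ 2. Proof. by rewrite lerDl sqr_ge0. Qed.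

Lemma pdf_derive (t : R) : is_derive t 1 pdf (- t * pdf t).
Proof.
have -> : pdf = (pdf 0) \*: (expR \o (- (2^-1 \*: (@GRing.exp R ^~ 2)))) :> (R -> R).
  by apply/funext => s; rewrite normal_pdf01E; congr (_ * expR (- _)); rewrite mulrC.
apply: is_derive_eq.
rewrite -![_ *: _]/(_ * _) /= -![_ *: _]/(_ * _).
by set e := expR _; field.
Qed.

Lemma pdf_bounded k : exists C : R, forall t, (1 + t ^+ 2) ^+ k * pdf t <= C.
Proof.
have [C C0 Cle] := weight_pdf_le k; exists (C * normal_peak (Num.sqrt 2)) => t.
rewrite (le_trans (Cle t))// ler_wpM2l// normal_pdf_ub// gt_eqF//.
Qed.

(** With [h] = g times the density, h' is (g' - t g) times the density, so the claim is that h' has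
    integral 0. This is the limit of the fundamental theorem of calculus on growing symmetric
    intervals, by dominated convergence. *)
Lemma normal_ibp (g g' : R -> R) (c : R) (k : nat) :
  (forall t : R, is_derive t 1 g (g' t)) -> continuous g' ->
  (forall t : R, `|g t| <= c * (1 + t ^+ 2) ^+ k) ->
  (forall t : R, `|g' t| <= c * (1 + t ^+ 2) ^+ k) ->
  (\int[N01]_t (t * g t)%:E = \int[N01]_t (g' t)%:E)%E.
Proof.
move=> dg cg' gc g'c.
have c0 : 0 <= c.
  by have := gc 0; rewrite expr0n addr0 expr1n mulr1; apply: le_trans.
have cg : continuous g.
  by move=> t; apply/differentiable_continuous/derivable1_diffP; have [] := dg t.
have cpdf : continuous pdf by apply: continuous_normal_pdf; rewrite oner_eq0.
pose h t := g t * pdf t; pose h' t := (g' t - t * g t) * pdf t.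
have dh (t : R) : is_derive t 1 h (h' t).
  have := pdf_derive t; have := dg t => ? ?.
  have -> : h = g * pdf by [].
  apply: is_derive_eq.
  by rewrite -![_ *: _]/(_ * _) /h'; ring.
have ctg : continuous (fun t : R => t * g t).
  by move=> t; apply: cvgM; [exact: cvg_id | exact: cg].
have ch' : continuous h'.
  move=> t; apply: cvgM; last exact: cpdf.
  by apply: cvgB; [exact: cg' | exact: ctg].
have mw := integrable_weight k.+1.
have int_le (f : R -> R) : continuous f -> (forall t, `|f t| <= c * (1 + t ^+ 2) ^+ k.+1) ->
    N01.-integrable setT (EFin \o f : measurableTypeR R -> _).
  move=> cf fle; apply: (@le_integrable _ _ R N01 setT measurableT _
    (fun t : measurableTypeR R => (c * (1 + t ^+ 2) ^+ k.+1)%:E)).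
  - by apply/measurable_EFinP; exact: continuous_measurable_fun.
  - move=> t _; rewrite /= lee_fin (le_trans (fle t))// ler_norm//.
  - under eq_fun do rewrite EFinM.
    exact: integrableZl.
have int_g' : N01.-integrable setT (EFin \o g' : measurableTypeR R -> _).
  apply: int_le => // t; rewrite (le_trans (g'c t))// ler_wpM2l// (exprS _ k) ler_peMl ?weight_ge1//.
  by rewrite exprn_ge0// (le_trans _ (weight_ge1 t)).
have int_tg : N01.-integrable setT (EFin \o (fun t => t * g t) : measurableTypeR R -> _).
  apply: int_le => // t; rewrite normrM (exprS _ k) mulrCA.
  by rewrite ler_pM ?normr_le_weight.
have int_g'tg : N01.-integrable setT (EFin \o (fun t => g' t - t * g t) : measurableTypeR R -> _).
  by rewrite /comp; under [X in _.-integrable _ X]eq_fun do rewrite EFinB; exact: integrableB.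
have int_h' : mu.-integrable setT (EFin \o h').
  apply/integrable_normal_probP => //.
  by apply: continuous_measurable_fun => t; apply: cvgB; [exact: cg' | exact: ctg].
suff h'0 : (\int[mu]_t (h' t)%:E = 0)%E.
  have : (\int[N01]_t (g' t - t * g t)%:E = 0)%E.
    rewrite integral_normal_prob//.
    by apply: continuous_measurable_fun => t; apply: cvgB; [exact: cg' | exact: ctg].
  under eq_integral do rewrite EFinB.
  rewrite integralB//.
  have := integrable_fin_num measurableT int_g'; have := integrable_fin_num measurableT int_tg.
  rewrite /comp => f1 f2; rewrite -(fineK f1) -(fineK f2) -EFinB => -[] /eqP.
  by rewrite subr_eq0 => /eqP ->.
(* The spare factor 1 + t^2 >= |t| in the power [k.+1] gives |h(t)| <= c C / |t|, so the boundary
   terms are squeezed by the harmonic sequence. *)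
have [C hC] := pdf_bounded k.+1.
have h_le (t : R) : `|h t| * (1 + t ^+ 2) <= c * C.
  rewrite normrM (ger0_norm (normal_pdf_ge0 _ _ _)).
  apply: (@le_trans _ _ (c * ((1 + t ^+ 2) ^+ k.+1 * pdf t))); last by rewrite ler_wpM2l.
  rewrite (exprSr _ k) (_ : c * _ = c * (1 + t ^+ 2) ^+ k * ((1 + t ^+ 2) * pdf t)); last by ring.
  rewrite [leLHS](_ : _ = `|g t| * ((1 + t ^+ 2) * pdf t)); last by ring.
  rewrite ler_wpM2r// mulr_ge0 ?normal_pdf_ge0//.
  exact: le_trans (weight_ge1 t).
pose D n : set (measurableTypeR R) := `[(- n.+1%:R : R), n.+1%:R]%classic.
have mD n : measurable (D n) by exact: measurable_itv.
have ID n : (\int[mu]_(t in D n) (h' t)%:E = (h n.+1%:R)%:E - (h (- n.+1%:R))%:E)%E.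
  apply: continuous_FTC2.
  - by rewrite gtrN.
  - by apply: continuous_subspaceT.
  - have ch : continuous h by move=> t; apply: cvgM; [exact: cg | exact: cpdf].
    split; first by move=> t _; have [] := dh t.
    + by apply: cvg_at_right_filter; exact: ch.
    + by apply: cvg_at_left_filter; exact: ch.
  - by move=> t _; rewrite derive1E; have ? := dh t; rewrite derive_val.
have lim0 : ((h n.+1%:R)%:E - (h (- n.+1%:R))%:E)%E @[n --> \oo] --> 0%E.
  apply: cvg_EFin; first exact: nearW.
  apply: norm_cvg0.
  apply: (@squeeze_cvgr _ _ _ _ (cst 0) (fun n => 2 * (c * C) * harmonic n)).
  - apply: nearW => n; rewrite normr_ge0/= (le_trans (ler_normB _ _))//.
    have bd (t : R) : n.+1%:R = `|t| -> `|h t| <= c * C * harmonic n.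
      move=> nt; rewrite /harmonic/= ler_pdivlMr// nt (le_trans _ (h_le t))//.
      by rewrite ler_wpM2l// normr_le_weight.
    rewrite -mulrA mulrDl mul1r lerD// bd// ?normrN ger0_norm//.
  - exact: cvg_cst.
  - rewrite -[X in _ --> X](mulr0 (2 * (c * C))); apply: cvgM; first exact: cvg_cst.
    exact: cvg_harmonic.
have limI : (\int[mu]_(t in D n) (h' t)%:E)%E @[n --> \oo] --> (\int[mu]_t (h' t)%:E)%E.
  have mh' : measurable_fun [set: measurableTypeR R] (EFin \o h').
    by apply/measurable_EFinP; exact: continuous_measurable_fun.
  have [//|||||_ _] := @dominated_convergence _ _ R mu setT measurableT
    (fun n => (EFin \o h') \_ (D n)) (EFin \o h') (fun t => `|(h' t)%:E|%E).
  - move=> n; apply: (measurable_restrictT (EFin \o h' : measurableTypeR R -> _) (mD n)).1.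
    exact: measurable_funTS.
  - exact: mh'.
  - apply: aeW => t _; apply: cvg_near_cst.
    exists (Num.bound `|t|) => // n /= tn.
    rewrite patchE ifT// inE /D /= in_itv/= -ler_norml.
    rewrite (le_trans (ltW (archi_boundP (normr_ge0 t))))// ler_nat.
    exact: (leq_trans tn).
  - exact: integrable_abse.
  - apply: aeW => t n _; rewrite patchE; case: ifPn => // _.
    by rewrite abse0 abse_ge0.
  - by under eq_fun do rewrite -integral_mkcond.
apply: (cvg_unique (@ereal_hausdorff R) limI).
have -> : (fun n => \int[mu]_(t in D n) (h' t)%:E)%E =
    (fun n => (h n.+1%:R)%:E - (h (- n.+1%:R))%:E)%E by apply/funext => n; exact: ID.
exact: lim0.
Qed.

End NormalMoments.

(** * Integrals of polynomially bounded functions over Gaussian space *)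

Section GaussianIntegral.
Context {R : realType}.
Local Notation N01 := (normal_prob (0 : R) 1).

(* [std_gaussian] on the canonical measurable structure of tuples, free of the
   coercion markers with which its type is elaborated. *)
Definition gauss n :
    probability (@tuple_tuple_of__canonical__measurable_structure_Measurable _
      (Real_sort__canonical__measurable_structure_SigmaRing R) n) R :=
  std_gaussian n.

Lemma gaussS n : gauss n.+1 = distribution (N01 \x gauss n)%E (@tuple_cons R n).
Proof. by []. Qed.

Lemma ge0_integral_gaussS n (f : n.+1.-tuple R -> \bar R) :
  measurable_fun setT f -> (forall x, (0 <= f x)%E) ->
  (\int[gauss n.+1]_x f x = \int[N01]_t \int[gauss n]_x f (tuple_cons (t, x)))%E.
Proof.
move=> mf f0; rewrite gaussS ge0_integral_distribution//.
rewrite (fubini_tonelli1 (f \o @tuple_cons R n))//; last by move=> x; exact: f0.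
exact: measurableT_comp.
Qed.

Definition weight n (k : nat) (x : n.-tuple R) : R :=
  \prod_(i < n) (1 + tnth x i ^+ 2) ^+ k.

Lemma weight_cons n k t (x : n.-tuple R) :
  weight k (tuple_cons (t, x)) = (1 + t ^+ 2) ^+ k * weight k x.
Proof.
rewrite /weight big_ord_recl; congr (_ * _).
by apply: eq_bigr => i _; rewrite /tuple_cons /= tnthS.
Qed.

Lemma weight_ge1n n k (x : n.-tuple R) : 1 <= weight k x.
Proof.
by apply: (big_ind (fun y => 1 <= y)) => // [*|i _]; rewrite ?mulr_ege1// exprn_ege1// weight_ge1.
Qed.

Lemma weightD n k l (x : n.-tuple R) : weight (k + l) x = weight k x * weight l x.
Proof. by rewrite -big_split; apply: eq_bigr => i _; rewrite exprD. Qed.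

Lemma measurable_weight n k : measurable_fun setT (@weight n k).
Proof.
apply: measurable_prod => i _; apply: measurable_funX; apply: measurable_funD => //.
by apply: measurable_funX; exact: measurable_tnth.
Qed.

Lemma integral_weight_lty n k : (\int[gauss n]_x (weight k x)%:E < +oo)%E.
Proof.
have mw m : measurable_fun setT (fun x : m.-tuple R => (weight k x)%:E).
  by apply/measurable_EFinP; exact: measurable_weight.
have w0 m (x : m.-tuple R) : 0 <= weight k x by exact: le_trans (weight_ge1n k x).
elim: n => [|n IH].
  under eq_integral do rewrite /weight big_ord0.
  by rewrite integral_cst//= mul1e probability_setT ltry.
have [w wE] : exists w : R, (\int[gauss n]_x (weight k x)%:E = w%:E)%E.
  exists (fine (\int[gauss n]_x (weight k x)%:E)); rewrite fineK// ge0_fin_numE//.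
  by apply: integral_ge0 => x _; rewrite lee_fin.
have t0 (t : R) : 0 <= (1 + t ^+ 2) ^+ k by rewrite exprn_ge0// (le_trans _ (weight_ge1 t)).
rewrite (ge0_integral_gaussS (f := fun x => (weight k x)%:E))//; last first.
  by move=> x; rewrite lee_fin.
under eq_integral => t _.
  under eq_integral => x _ do rewrite weight_cons EFinM.
  rewrite ge0_integralZl//; first last.
    by rewrite lee_fin.
    by move=> x _; rewrite lee_fin.
    exact: mw.
  rewrite wE; over.
have intw := integrable_weight k (R := R).
rewrite integralZr// -(fineK (integrable_fin_num measurableT intw)).
by rewrite -EFinM ltry.
Qed.

(* The weights replace powers of |x|: they factor over the coordinates. *)
Definition polyb n (f : n.-tuple R -> R) : Prop :=
  measurable_fun setT f /\ exists c k, forall x, `|f x| <= c * weight k x.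

Lemma polyb_integrable n (f : n.-tuple R -> R) : polyb f ->
  (gauss n).-integrable setT (EFin \o f).
Proof.
move=> [mf [c [k fle]]].
have mw : measurable_fun setT (fun x : n.-tuple R => (weight k x)%:E).
  by apply/measurable_EFinP; exact: measurable_weight.
apply: (@le_integrable _ _ R (gauss n) setT measurableT _
  (fun x => (c * weight k x)%:E)).
- exact/measurable_EFinP.
- by move=> x _; rewrite /= lee_fin (le_trans (fle x))// ler_norm.
- under eq_fun do rewrite EFinM.
  apply: integrableZl => //; apply/integrableP; split=> //.
  under eq_integral => x _ do rewrite gee0_abs ?lee_fin ?(le_trans _ (weight_ge1n k x))//.
  exact: integral_weight_lty.
Qed.

Lemma integrable_gauss_cons n (f : n.+1.-tuple R -> R) : polyb f ->
  (N01 \x gauss n)%E.-integrable setT (fun p => (f (tuple_cons p))%:E).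
Proof.
move=> pf; have /integrableP[mf fi] := polyb_integrable pf.
apply/integrableP; split.
  by apply: (measurableT_comp mf); exact: measurable_tuple_cons.
move: fi; rewrite gaussS ge0_integral_distribution//; first exact: measurableT_comp.
Qed.

Lemma integral_gaussS n (f : n.+1.-tuple R -> R) : polyb f ->
  (\int[gauss n.+1]_x (f x)%:E = \int[N01]_t \int[gauss n]_x (f (tuple_cons (t, x)))%:E)%E.
Proof.
move=> pf; have i := integrable_gauss_cons pf.
rewrite gaussS integral_distribution//; last by apply/measurable_EFinP; case: pf.
by rewrite -(integral12_prod_meas1 i).
Qed.

Lemma integral_gaussS' n (f : n.+1.-tuple R -> R) : polyb f ->
  (\int[gauss n.+1]_x (f x)%:E = \int[gauss n]_x \int[N01]_t (f (tuple_cons (t, x)))%:E)%E.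
Proof.
move=> pf; have i := integrable_gauss_cons pf.
rewrite gaussS integral_distribution//; last by apply/measurable_EFinP; case: pf.
by rewrite -(integral21_prod_meas1 i).
Qed.

Definition tset n (x : n.-tuple R) (j : 'I_n) (t : R) : n.-tuple R :=
  [tuple if i == j then t else tnth x i | i < n].

Lemma tset_cons0 n t s (x : n.-tuple R) :
  tset (tuple_cons (t, x)) ord0 s = tuple_cons (s, x).
Proof.
apply: eq_from_tnth => i; rewrite tnth_mktuple.
by case: (unliftP ord0 i) => [j ->|->]; rewrite ?eqxx// eq_sym (negPf (neq_lift _ _)) !tnthS.
Qed.

Lemma tset_consS n t s (x : n.-tuple R) j :
  tset (tuple_cons (t, x)) (lift ord0 j) s = tuple_cons (t, tset x j s).
Proof.
apply: eq_from_tnth => i; rewrite tnth_mktuple.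
case: (unliftP ord0 i) => [k ->|->] //=.
by rewrite (inj_eq lift_inj) !tnthS tnth_mktuple.
Qed.

Lemma polyb_cons n (f : n.+1.-tuple R -> R) t : polyb f ->
  polyb (fun x => f (tuple_cons (t, x))).
Proof.
move=> [mf [c [k fle]]]; split.
  apply: (measurableT_comp mf); apply: (measurableT_comp (@measurable_tuple_cons R n)).
  exact: measurable_pair1.
exists (c * (1 + t ^+ 2) ^+ k), k => x; rewrite -mulrA -weight_cons.
exact: fle.
Qed.

Lemma gauss_ibp n (j : 'I_n) (g g' : n.-tuple R -> R) :
  polyb g -> polyb g' -> polyb (fun x => tnth x j * g x) ->
  (forall x (t : R), is_derive t 1 (fun s : R => g (tset x j s)) (g' (tset x j t))) ->
  (forall x, continuous (fun s : R => g' (tset x j s))) ->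
  (\int[gauss n]_x (tnth x j * g x)%:E = \int[gauss n]_x (g' x)%:E)%E.
Proof.
elim: n j g g' => [[]//|n IH] j g g' pg pg' pxg dg cg'.
case: (unliftP ord0 j) => [i ji|j0]; last first.
  subst j; rewrite !integral_gaussS'//; apply: eq_integral => x _.
  under eq_integral => t _ do rewrite [tnth _ _]/=.
  have [_ [c [k gc]]] := pg; have [_ [c' [k' gc']]] := pg'.
  have w0 : 0 <= (weight (maxn k k') x) by exact: le_trans (weight_ge1n _ _).
  have mono l t : (l <= maxn k k')%N ->
      weight l (tuple_cons (t, x)) <= (1 + t ^+ 2) ^+ maxn k k' * weight (maxn k k') x.
    move=> lk; rewrite -weight_cons -(subnKC lk) weightD ler_peMr ?weight_ge1n//.
    exact: le_trans (weight_ge1n _ _).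
  apply: (@normal_ibp _ _ (fun t => g' (tuple_cons (t, x)))
     ((`|c| + `|c'|) * weight (maxn k k') x) (maxn k k')) => [t|t|t|t].
  - have := dg (tuple_cons (0, x)) t; rewrite tset_cons0.
    by under eq_fun do rewrite tset_cons0.
  - have := cg' (tuple_cons (0, x)) t.
    by under eq_fun do rewrite tset_cons0.
  - rewrite (le_trans (gc _))// mulrAC -mulrA.
    rewrite (le_trans (ler_wpM2r _ (ler_norm c)))//; first exact: le_trans (weight_ge1n _ _).
    rewrite ler_pM//; first exact: le_trans (weight_ge1n _ _).
      by rewrite lerDl.
    by rewrite mono// leq_maxl.
  - rewrite (le_trans (gc' _))// mulrAC -mulrA.
    rewrite (le_trans (ler_wpM2r _ (ler_norm c')))//; first exact: le_trans (weight_ge1n _ _).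
    rewrite ler_pM//; first exact: le_trans (weight_ge1n _ _).
      by rewrite lerDr.
    by rewrite mono// leq_maxr.
subst j; rewrite !integral_gaussS//; apply: eq_integral => t _.
under eq_integral => x _ do rewrite tnthS.
apply: IH.
- exact: polyb_cons.
- exact: polyb_cons.
- by have := polyb_cons t pxg; under eq_fun do rewrite tnthS.
- move=> x s; have := dg (tuple_cons (t, x)) s; rewrite tset_consS.
  by under eq_fun do rewrite tset_consS.
- move=> x; have := cg' (tuple_cons (t, x)).
  by under eq_fun do rewrite tset_consS.
Qed.

End GaussianIntegral.

Section PolynomialBounds.
Context {R : realType}.
Local Notation gauss n := (@gauss R n).

Lemma polyb_le n (f g : n.-tuple R -> R) : measurable_fun setT f ->
  polyb g -> (forall x, `|f x| <= `|g x|) -> polyb f.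
Proof.
move=> mf [_ [c [k gc]]] fg; split=> //; exists c, k => x.
exact: le_trans (fg x) (gc x).
Qed.

Lemma polyb_cst n (c : R) : polyb (fun _ : n.-tuple R => c).
Proof.
split; first exact: measurable_cst.
exists `|c|, 0%N => x; rewrite /weight big1 ?mulr1// => i _; exact: expr0.
Qed.

Lemma polyb_tnth n (i : 'I_n) : polyb (fun x : n.-tuple R => tnth x i).
Proof.
split; first exact: measurable_tnth.
exists 1, 1%N => x; rewrite mul1r /weight (bigD1 i) //= expr1.
rewrite (le_trans (normr_le_weight _))// ler_peMr ?(le_trans _ (weight_ge1 _))//.
by apply: (big_ind (fun y => 1 <= y)) => // [*|j _]; rewrite ?mulr_ege1// expr1 weight_ge1.
Qed.

Lemma polybM n (f g : n.-tuple R -> R) : polyb f -> polyb g -> polyb (fun x => f x * g x).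
Proof.
move=> [mf [c [k fc]]] [mg [c' [k' gc]]]; split; first exact: measurable_funM.
exists (c * c'), (k + k')%N => x; rewrite normrM weightD mulrACA.
by rewrite ler_pM.
Qed.

Lemma polybD n (f g : n.-tuple R -> R) : polyb f -> polyb g -> polyb (fun x => f x + g x).
Proof.
move=> [mf [c [k fc]]] [mg [c' [k' gc]]]; split; first exact: measurable_funD.
exists (`|c| + `|c'|), (k + k')%N => x; rewrite (le_trans (ler_normD _ _))// mulrDl.
have w1 l := weight_ge1n l x; have w0 l : 0 <= weight l x by exact: le_trans (w1 l).
apply: lerD.
- rewrite (le_trans (fc x))// (le_trans (ler_wpM2r _ (ler_norm c)))// ler_wpM2l//.
  by rewrite weightD ler_peMr.
- rewrite (le_trans (gc x))// (le_trans (ler_wpM2r _ (ler_norm c')))// ler_wpM2l//.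
  by rewrite weightD ler_peMl.
Qed.

Lemma polybN n (f : n.-tuple R -> R) : polyb f -> polyb (fun x => - f x).
Proof.
by move=> /(polybM (polyb_cst _ (-1))); under eq_fun do rewrite mulN1r.
Qed.

Lemma polyb_norm n (f : n.-tuple R -> R) : polyb f -> polyb (fun x => `|f x|).
Proof.
move=> pf; apply: (polyb_le _ pf) => [|x]; last by rewrite normr_id.
by apply: measurableT_comp => //; case: pf.
Qed.

Lemma polyb_sum n (I : Type) (r : seq I) (P : pred I) (f : I -> n.-tuple R -> R) :
  (forall i, polyb (f i)) -> polyb (fun x => \sum_(i <- r | P i) f i x).
Proof.
move=> pf; elim: r => [|i r IH].
  by under eq_fun do rewrite big_nil; exact: polyb_cst.
under eq_fun do rewrite big_cons; case: (P i) => //.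
exact: polybD.
Qed.

Lemma polyb_peval n (p : mpoly n R) : polyb (peval p).
Proof.
move: p; apply: mpoly_alg_ind => [c|p q pp pq|j p pp].
- rewrite /peval; under eq_fun do rewrite mevalC; exact: polyb_cst.
- rewrite /peval; under eq_fun do rewrite mevalD; exact: polybD.
- rewrite /peval; under eq_fun do rewrite mevalM mevalXU.
  by apply: polybM => //; exact: polyb_tnth.
Qed.

Lemma peval_derive n (p : mpoly n R) (x : n.-tuple R) j (t : R) :
  is_derive t 1 (fun s : R => peval p (tset x j s)) (peval (mderiv j p) (tset x j t)).
Proof.
move: p; apply: mpoly_alg_ind => [c|p q dp dq|i p dp]; rewrite /peval.
- under eq_fun do rewrite mevalC; rewrite mderivC meval0; exact: is_derive_cst.
- under eq_fun do rewrite mevalD.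
  by rewrite mderivD mevalD; exact: is_deriveD.
- under eq_fun do rewrite mevalM mevalXU.
  rewrite mderivM mderiv_var mevalD !mevalM mevalXU.
  have dt : is_derive t 1 (fun s : R => tnth (tset x j s) i) ((j == i)%:R : R).
    have [ij|ij] := eqVneq i j.
      subst i; rewrite (_ : (fun s => _) = id); first exact: is_derive_id.
      by apply/funext => s; rewrite tnth_mktuple eqxx.
    rewrite (_ : (fun s => _) = cst (tnth x i)); first exact: is_derive_cst.
    by apply/funext => s; rewrite tnth_mktuple (negPf ij).
  apply: (is_derive_eq (is_deriveM dt dp)).
  rewrite -![_ *: _]/(_ * _) addrC mulrC; congr (_ * _ + _).
  by case: (j == i); rewrite ?meval1 ?meval0.
Qed.

Lemma continuous_peval_tset n (p : mpoly n R) (x : n.-tuple R) j :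
  continuous (fun s : R => peval p (tset x j s)).
Proof.
move=> t; apply/differentiable_continuous/derivable1_diffP.
by have [] := peval_derive p x j t.
Qed.

Definition expect n (f : n.-tuple R -> R) : R := \int[gauss n]_x f x.

Lemma expectE n (f : n.-tuple R -> R) : polyb f ->
  (\int[gauss n]_x (f x)%:E = (expect f)%:E)%E.
Proof.
by move=> pf; rewrite fineK// (integrable_fin_num measurableT (polyb_integrable pf)).
Qed.

Lemma expectD n (f g : n.-tuple R -> R) : polyb f -> polyb g ->
  expect (fun x => f x + g x) = expect f + expect g.
Proof. by move=> pf pg; rewrite /expect RintegralD//; exact: polyb_integrable. Qed.

Lemma expectZ n c (f : n.-tuple R -> R) : polyb f ->
  expect (fun x => c * f x) = c * expect f.
Proof. by move=> pf; rewrite /expect RintegralZl//; exact: polyb_integrable. Qed.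

Lemma expectB n (f g : n.-tuple R -> R) : polyb f -> polyb g ->
  expect (fun x => f x - g x) = expect f - expect g.
Proof. by move=> pf pg; rewrite /expect RintegralB//; exact: polyb_integrable. Qed.

Lemma expect_cst n (c : R) : expect (fun _ : n.-tuple R => c) = c.
Proof.
by rewrite /expect Rintegral_cst//= probability_setT mulr1.
Qed.

Lemma expect_sum n (I : Type) (r : seq I) (f : I -> n.-tuple R -> R) :
  (forall i, polyb (f i)) ->
  expect (fun x => \sum_(i <- r) f i x) = \sum_(i <- r) expect (f i).
Proof.
move=> pf; elim: r => [|i r IH].
  rewrite big_nil -[RHS](expect_cst n); apply: eq_Rintegral => x _.
  by rewrite big_nil.
rewrite big_cons -IH -expectD//; last exact: polyb_sum.
by apply: eq_Rintegral => x _; rewrite big_cons.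
Qed.

Lemma le_expect n (f g : n.-tuple R -> R) : polyb f -> polyb g ->
  (forall x, f x <= g x) -> expect f <= expect g.
Proof.
by move=> pf pg fg; apply: le_Rintegral => //; exact: polyb_integrable.
Qed.

Lemma expect_norm_le n (f : n.-tuple R -> R) : polyb f ->
  `|expect f| <= expect (fun x => `|f x|).
Proof.
move=> pf; rewrite ler_norml; apply/andP; split.
  rewrite -mulN1r -expectZ; last exact: polyb_norm.
  apply: le_expect => // [|x]; last by rewrite mulN1r lerNl -normrN ler_norm.
  by apply: polybM; [exact: polyb_cst | exact: polyb_norm].
by apply: le_expect => // [|x]; [exact: polyb_norm | exact: ler_norm].
Qed.

Lemma expect_ibp n (j : 'I_n) (g g' : n.-tuple R -> R) :
  polyb g -> polyb g' ->
  (forall x (t : R), is_derive t 1 (fun s : R => g (tset x j s)) (g' (tset x j t))) ->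
  (forall x, continuous (fun s : R => g' (tset x j s))) ->
  expect (fun x => tnth x j * g x) = expect g'.
Proof.
move=> pg pg' dg cg'; rewrite /expect /Rintegral; congr fine.
by apply: gauss_ibp => //; apply: polybM => //; exact: polyb_tnth.
Qed.

(** This is the functional to which the algebraic part is applied. *)
Definition mexpect n (p : mpoly n R) : R := expect (peval p).

Lemma mexpect_is_linear n : scalar (@mexpect n).
Proof.
move=> c p q; rewrite /mexpect -expectZ; last exact: polyb_peval.
rewrite -expectD; last 2 first.
- by apply: polybM; [exact: polyb_cst | exact: polyb_peval].
- exact: polyb_peval.
by apply: eq_Rintegral => x _; rewrite /peval mevalD mevalZ.
Qed.
HB.instance Definition _ n := GRing.isLinear.Build R (mpoly n R) R _ (@mexpect n)
  (@mexpect_is_linear n).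

Lemma mexpect1 n : mexpect (1 : mpoly n R) = 1.
Proof.
rewrite -[RHS](expect_cst n); apply: eq_Rintegral => x _; exact: meval1.
Qed.

Lemma mexpect_ibp n (j : 'I_n) (p : mpoly n R) :
  mexpect (mpolyX R (mnm1 j) * p) = mexpect (mderiv j p).
Proof.
rewrite -[RHS](expect_ibp (j := j) (polyb_peval p)); last 3 first.
- exact: polyb_peval.
- by move=> x t; exact: peval_derive.
- by move=> x; exact: continuous_peval_tset.
by apply: eq_Rintegral => x _; rewrite /peval mevalM mevalXU.
Qed.

End PolynomialBounds.

(** * Smooth functions composed with polynomials *)

Section SmoothChainRule.
Context {R : realType} {r : nat}.
Implicit Types (a : 'rV[R]_r -> R) (x v : 'rV[R]_r).

Lemma continuous_rV_ball a x (e : R) : continuous a -> 0 < e ->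
  exists2 de : R, 0 < de &
    forall y : 'rV[R]_r, (forall b, `|y 0 b - x 0 b| < de) -> `|a y - a x| < e.
Proof.
move=> ca e0; have := ca x => /cvgrPdist_lt/(_ e e0)/nbhs_ballP[de /= de0 h].
exists de => // y yx; rewrite distrC; apply: h; split=> // i b; rewrite ord1.
by rewrite /ball /= distrC; exact: yx.
Qed.

Lemma partial_mvt a i x (t : R) : C1 a ->
  exists2 s : R, `|s| <= `|t| &
    a (x + t *: delta_mx 0 i) - a x = t * partial i a (x + s *: delta_mx 0 i).
Proof.
move=> [ca da cpa]; pose g (u : R) := a (x + u *: delta_mx 0 i).
have dg (u : R) : is_derive u 1 g (partial i a (x + u *: delta_mx 0 i)).
  have dau := da i (x + u *: delta_mx 0 i).
  have e : (fun h : R => h^-1 *: (g (h *: 1 + u) - g u)) =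
      (fun h : R => h^-1 *: (a (h *: delta_mx 0 i + (x + u *: delta_mx 0 i)) - a (x + u *: delta_mx 0 i))).
    apply/funext => h; rewrite /g; congr (_ *: (a _ - _)).
    by rewrite -[h *: 1]/(h * 1) mulr1 scalerDl addrCA.
  by apply: DeriveDef; rewrite /derivable /derive /partial /derive e.
have cg : continuous g.
  by move=> u; apply/differentiable_continuous/derivable1_diffP; have [] := dg u.
have gE0 : g 0 = a x by rewrite /g scale0r addr0.
have [t0|t0|->] := ltgtP t 0.
- have [s] := @MVT _ g _ _ _ t0 (fun u _ => dg u) (continuous_subspaceT cg).
  rewrite in_itv/= => /andP[ts s0]; rewrite gE0 sub0r => e.
  exists s; first by rewrite !ltr0_norm// lerN2 ltW.
  by rewrite -/(g t) mulrC -[LHS]opprB e mulrN opprK.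
- have [s] := @MVT _ g _ _ _ t0 (fun u _ => dg u) (continuous_subspaceT cg).
  rewrite in_itv/= => /andP[s0 st]; rewrite gE0 subr0 => e.
  exists s; first by rewrite !gtr0_norm// ltW.
  by rewrite mulrC.
- by exists 0 => //; rewrite scale0r addr0 subrr mul0r.
Qed.

(** [C1] speaks of partial derivatives only, so differentiability has to be derived: going from x to
    x + v one coordinate at a time (through [z]), each increment is a partial derivative at a nearby
    point, by the mean value theorem. *)
Lemma C1_taylor a x (e : R) : C1 a -> 0 < e ->
  exists2 de : R, 0 < de &
    forall v : 'rV[R]_r, (forall b, `|v 0 b| < de) ->
      `|a (x + v) - a x - \sum_(b < r) v 0 b * partial b a x| <=
        e * \sum_(b < r) `|v 0 b|.
Proof.
move=> C1a e0; have [ca da cpa] := C1a.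
have /choice[de_ de_P] b : exists de : R, 0 < de /\
    forall y : 'rV[R]_r, (forall b', `|y 0 b' - x 0 b'| < de) -> `|partial b a y - partial b a x| < e.
  by have [de ? ?] := continuous_rV_ball x (cpa b) e0; exists de.
pose de := \big[Num.min/1]_(b < r) de_ b.
have de0 : 0 < de by apply: lt_bigmin => // b _; have [] := de_P b.
exists de => // v vde.
pose z k : 'rV[R]_r := \row_b (if (b < k)%N then v 0 b else 0).
have -> : a (x + v) - a x = \sum_(k < r) (a (x + z k.+1) - a (x + z k)).
  rewrite -(big_mkord xpredT (fun k => a (x + z k.+1) - a (x + z k))).
  rewrite (telescope_sumr (fun k => a (x + z k)))//.
  have -> : z r = v by apply/rowP => b; rewrite mxE ltn_ord.
  have -> : z 0%N = 0 by apply/rowP => b; rewrite !mxE.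
  by rewrite addr0.
rewrite -sumrB (le_trans (ler_norm_sum _ _ _))// mulr_sumr; apply: ler_sum => k _.
have -> : z k.+1 = z k + v 0 k *: delta_mx 0 k.
  apply/rowP => b; rewrite !mxE eqxx /= ltnS leq_eqVlt.
  have [->|bk] := eqVneq b k; first by rewrite eqxx ltnn add0r mulr1.
  by rewrite (inj_eq val_inj) (negPf bk) /= mulr0 addr0.
rewrite addrA; have [s sv ->] := partial_mvt k (x + z k) (v 0 k) C1a.
rewrite -mulrBr normrM mulrC ler_wpM2r// ltW//.
apply: (de_P k).2 => b; rewrite !mxE eqxx /=.
apply: (@lt_le_trans _ _ de); last exact: bigmin_le_cond.
rewrite -[x 0 b + _ + _]addrA [_ - x 0 b]addrAC subrr add0r.
have [->|bk] := eqVneq b k; first by rewrite ltnn add0r mulr1 (le_lt_trans sv).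
by rewrite mulr0 addr0; case: ifP => // _; rewrite normr0.
Qed.

Lemma chain_rule_C1 a (w : 'I_r -> R -> R) (w' : 'I_r -> R) (t : R) : C1 a ->
  (forall b, is_derive t 1 (w b) (w' b)) ->
  is_derive t 1 (fun s : R => a (\row_b w b s))
    (\sum_(b < r) w' b * partial b a (\row_b w b t)).
Proof.
move=> C1a dw; set W := fun s : R => \row_b w b s.
pose q b (h : R) := h^-1 *: (w b (h *: 1 + t) - w b t).
have qw b : q b h @[h --> 0^'] --> w' b.
  by have [dwb <-] := dw b; exact: dwb.
pose D (h : R) : R := a (W (h *: 1 + t)) - a (W t) -
  \sum_(b < r) (w b (h *: 1 + t) - w b t) * partial b a (W t).
have D0 : h^-1 *: D h @[h --> 0^'] --> (0 : R).
  (* Near 0 each difference quotient is at most |w' b| + 1, so [M] turns the Taylor error e / M into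
     e; the last 1 keeps [M] positive when r = 0. *)
  apply/cvgrPdist_le => e e0; pose M := \sum_(b < r) (`|w' b| + 1) + 1.
  have M0 : 0 < M by rewrite ltr_wpDl// sumr_ge0// => b _; rewrite addr_ge0.
  have [de de0 taylor] := C1_taylor (W t) C1a (divr_gt0 e0 M0).
  have near_w : \forall h \near (0 : R)^', forall b, `|w b (h *: 1 + t) - w b t| < de.
    apply: filter_forall => b.
    have cw : w b (h *: 1 + t) @[h --> (0 : R)] --> w b t.
      have cb : {for t, continuous (w b)}.
        by apply/differentiable_continuous/derivable1_diffP; have [] := dw b.
      have ct : h *: 1 + t @[h --> (0 : R)] --> t.
        rewrite -{2}(add0r t); apply: cvgD; last exact: cvg_cst.
        by under eq_fun do rewrite -[_ *: _]/(_ * _) mulr1; exact: cvg_id.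
      exact: (cvg_comp _ _ ct cb).
    move: cw => /cvgrPdist_lt/(_ de de0) nw.
    have : \forall h \near (0 : R)^', `|w b t - w b (h *: 1 + t)| < de by exact: nbhs_dnbhs nw.
    by apply: filterS => h; rewrite distrC.
  have near_q : \forall h \near (0 : R)^', forall b, `|q b h| <= `|w' b| + 1.
    apply: filter_forall => b.
    have /cvgrPdist_le/(_ 1 ltr01) := qw b.
    apply: filterS => h qh; rewrite -[q b h](subrK (w' b)) addrC.
    by rewrite (le_trans (ler_normD _ _))// lerD2l distrC.
  near=> h; rewrite sub0r normrN normrZ.
  have h0 : h != 0 by near: h; exact: nbhs_dnbhs_neq.
  have hw : forall b, `|w b (h *: 1 + t) - w b t| < de by near: h.
  have hq : forall b, `|q b h| <= `|w' b| + 1 by near: h.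
  have := taylor (W (h *: 1 + t) - W t).
  have Wb b : (W (h *: 1 + t) - W t) 0 b = w b (h *: 1 + t) - w b t by rewrite !mxE.
  move=> /(_ _)/wrap[b|]; first by rewrite Wb.
  rewrite (addrC (W t)) subrK; under eq_bigr => b _ do rewrite Wb.
  under [X in _ <= _ * X]eq_bigr => b _ do rewrite Wb.
  rewrite -/(D h) => Dh.
  apply: (@le_trans _ _ (`|h^-1| * (e / M * \sum_(b < r) `|w b (h *: 1 + t) - w b t|))).
    by rewrite ler_wpM2l.
  rewrite mulrCA mulr_sumr; under eq_bigr => b _ do rewrite -normrM.
  rewrite mulrAC -mulrA ler_piMr ?(ltW e0)// ler_pdivrMr// mul1r /M.
  rewrite (le_trans (_ : _ <= \sum_(b < r) (`|w' b| + 1)))// ?lerDl//.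
  by apply: ler_sum => b _; exact: hq.
have Q : h^-1 *: (a (W (h *: 1 + t)) - a (W t)) @[h --> 0^'] -->
    \sum_(b < r) w' b * partial b a (W t).
  rewrite -[X in _ --> X]add0r.
  have -> : (fun h : R => h^-1 *: (a (W (h *: 1 + t)) - a (W t))) =
     (fun h => h^-1 *: D h + \sum_(b < r) q b h * partial b a (W t)).
    apply/funext => h; under eq_bigr => b _ do rewrite -[q b h]/(_ * _) -mulrA.
    by rewrite -mulr_sumr -[RHS]mulrDr /D subrK.
  apply: cvgD => //; apply: (cvg_big (op := +%R)) => [|b _]; first exact: add_continuous.
  by apply: cvgM => //; exact: cvg_cst.
apply: DeriveDef; first by apply/cvg_ex; eexists; exact: Q.
exact: cvg_lim Q.
Unshelve. all: by end_near.
Qed.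

End SmoothChainRule.

Section SmoothFunctionsOfPolynomials.
Context {R : realType} {r : nat}.
Implicit Types (a h : 'rV[R]_r -> R).

Lemma continuous_row a (w : 'I_r -> R -> R) :
  continuous a -> (forall b, continuous (w b)) ->
  continuous (fun s : R => a (\row_b w b s)).
Proof.
move=> ca cw t; apply/cvgrPdist_lt => e e0.
have [de de0 hde] := continuous_rV_ball (\row_b w b t) ca e0.
have nw : \forall s \near t, forall b, `|w b s - w b t| < de.
  apply: (@filter_forall _ _ (fun b s => `|w b s - w b t| < de) _ (nbhs_filter t)) => b; have /cvgrPdist_lt/(_ de de0) := cw b t.
  by apply: filterS => s; rewrite distrC.
by apply: filterS nw => s sw; rewrite distrC; apply: hde => b; rewrite !mxE.
Qed.

(** The open set a > c is a countable union of l1-balls with rational centres and radii 1/(k+1). The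
    preimage of such a ball is a sublevel set of a finite sum of measurable functions. *)
Lemma measurable_row d (T : measurableType d) a (w : 'I_r -> T -> R) :
  continuous a -> (forall b, measurable_fun setT (w b)) ->
  measurable_fun setT (fun x => a (\row_b w b x)).
Proof.
move=> ca mw; pose l1 (q : {ffun 'I_r -> rat}) (y : 'rV[R]_r) : R := \sum_b `|y 0 b - ratr (q b)|.
apply: (measurability _ (RGenOInfty.measurableE R)) => _ [_ [c ->] <-].
rewrite setTI; set B := _ @^-1` _.
pose P (qk : {ffun 'I_r -> rat} * nat) :=
  forall y, l1 qk.1 y < qk.2.+1%:R^-1 -> c < a y.
pose F n : set T := if unpickle n is Some qk then
  (if pselect (P qk) then [set x | l1 qk.1 (\row_b w b x) < qk.2.+1%:R^-1] else set0)
  else set0.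
have -> : B = \bigcup_n F n.
  apply/seteqP; split=> [x|x [n _]]; rewrite /B /F /= ?in_itv/= ?andbT; last first.
    by case: unpickle => // qk; case: pselect => // Pqk; exact: Pqk.
  move=> cx; have acx : 0 < a (\row_b w b x) - c by rewrite subr_gt0.
  have [de de0 hde] := continuous_rV_ball (\row_b w b x) ca acx.
  (* Two points of an l1-ball of radius 1/(k+1) are less than 2/(k+1) < de apart. The factor r+1
     below keeps the sum of the r coordinate errors under that radius. *)
  have [k kde] : exists k : nat, 2 * k.+1%:R^-1 < de.
    have d0 : 0 <= 2 / de by rewrite divr_ge0// ltW.
    exists (Num.bound (2 / de)); rewrite ltr_pdivrMr// mulrC -ltr_pdivrMr//.
    by rewrite (lt_trans (archi_boundP d0))// ltr_nat.
  have k0 : 0 < (r.+1%:R * k.+1%:R)^-1 :> R by rewrite invr_gt0 mulr_gt0.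
  have /choice[q qP] b : exists q : rat, `|w b x - ratr q| < (r.+1%:R * k.+1%:R)^-1.
    have : w b x - (r.+1%:R * k.+1%:R)^-1 < w b x + (r.+1%:R * k.+1%:R)^-1.
      by rewrite ltrBlDr -addrA ltrDl addr_gt0.
    move=> /rat_in_itvoo[q]; rewrite in_itv/= => qx; exists q.
    by rewrite distrC ltr_distl.
  have qx : l1 (finfun q) (\row_b w b x) < k.+1%:R^-1.
    apply: (@le_lt_trans _ _ (\sum_(b < r) (r.+1%:R * k.+1%:R)^-1)).
      by apply: ler_sum => b _; rewrite mxE ffunE ltW.
    rewrite sumr_const card_ord -(mulr_natl _ r) invfM mulrA -[ltRHS]mul1r.
    by rewrite ltr_pM2r ?invr_gt0// ltr_pdivrMr// mul1r ltr_nat.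
  exists (pickle (finfun q, k)) => //; rewrite /F pickleK; case: pselect => //= nP.
  apply: nP => y /= yq; have : `|a y - a (\row_b w b x)| < a (\row_b w b x) - c.
    apply: hde => b; apply: le_lt_trans kde; rewrite mulrDl mul1r.
    have le_l1 (z : 'rV[R]_r) : `|z 0 b - ratr (q b)| <= l1 (finfun q) z.
      rewrite /l1 (bigD1 b) //= ffunE lerDl.
      by apply: sumr_ge0.
    rewrite -(subrK (ratr (q b)) (y 0 b)) -addrA (le_trans (ler_normD _ _))//.
    by rewrite lerD ?(le_trans (le_l1 _))// 1?distrC ?(le_trans (le_l1 _)) ?ltW.
  by rewrite ltr_distl => /andP[+ _]; rewrite opprB addrC subrK.
have l1E q x : l1 q (\row_b w b x) = \sum_b `|w b x - ratr (q b)|.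
  by apply: eq_bigr => b _; rewrite mxE.
apply: bigcupT_measurable => n; rewrite /F; case: unpickle => // -[q k].
case: (pselect (P (q, k))) => [Pqk|nPqk] /=; last exact: measurable0.
rewrite [X in measurable X](_ : _ =
  (fun x => \sum_b `|w b x - ratr (q b)|) @^-1` `]-oo, k.+1%:R^-1[%classic); last first.
  by apply/seteqP; split=> x /=; rewrite in_itv/= l1E.
rewrite -[X in measurable X]setTI.
have mf : measurable_fun setT (fun x => \sum_b `|w b x - ratr (q b)|).
  apply: measurable_sum => b; apply: measurableT_comp => //.
  by apply: measurable_funB.
exact: mf.
Qed.

(** Mean value theorem on the segment from 0 to v. Since the bound is required on this segment only,
    [B] may depend on [v], which allows a second application with the linear growth of the
    gradient. *)
Lemma C1_growth a (B : R) (v : 'rV[R]_r) : C1 a ->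
  (forall b (s : R), 0 <= s <= 1 -> `|partial b a (s *: v)| <= B) ->
  `|a v| <= `|a 0| + B * \sum_(b < r) `|v 0 b|.
Proof.
move=> C1a aB; pose w b (s : R) := s * v 0 b.
have wE s : \row_b w b s = s *: v by apply/rowP => b; rewrite !mxE.
have dw b (s : R) : is_derive s 1 (w b) (v 0 b).
  apply: (is_derive_eq (is_deriveM (is_derive_id s 1) (is_derive_cst (v 0 b) s 1))).
  by rewrite scaler0 add0r -[_ *: _]/(_ * _) mulr1.
have dg (s : R) := chain_rule_C1 C1a (dw ^~ s).
have cg : continuous (fun s : R => a (\row_b w b s)).
  by move=> u; apply/differentiable_continuous/derivable1_diffP; have [] := dg u.
have [s] := @MVT _ _ _ _ _ ltr01 (fun u _ => dg u) (continuous_subspaceT cg).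
rewrite in_itv/= => /andP[s0 s1]; rewrite !wE scale1r scale0r subr0 mulr1 => e.
rewrite -[a v](subrK (a 0)) e addrC (le_trans (ler_normD _ _))// lerD2l mulr_sumr.
rewrite (le_trans (ler_norm_sum _ _ _))//; apply: ler_sum => b _.
by rewrite normrM mulrC ler_wpM2r// aB// !ltW.
Qed.

Definition prow n (w : 'I_r -> mpoly n R) (x : n.-tuple R) : 'rV[R]_r :=
  \row_b peval (w b) x.

Lemma polyb_C1 n a (B : R) (w : 'I_r -> mpoly n R) : C1 a ->
  (forall b x, `|partial b a x| <= B) -> polyb (fun x => a (prow w x)).
Proof.
move=> C1a aB; have pw b := polyb_peval (w b).
apply: (@polyb_le _ _ _ (fun x => `|a 0| + B * \sum_(b < r) `|peval (w b) x|)).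
- by apply: measurable_row => [|b]; [case: C1a | case: (pw b)].
- apply: polybD; first exact: polyb_cst.
  apply: polybM; first exact: polyb_cst.
  by apply: polyb_sum => b; exact: polyb_norm.
- move=> x; rewrite (le_trans (C1_growth C1a (fun b s _ => aB b _)))//.
  under eq_bigr => b _ do rewrite mxE.
  exact: ler_norm.
Qed.

Lemma polyb_bounded n a (B : R) (w : 'I_r -> mpoly n R) : continuous a ->
  (forall x, `|a x| <= B) -> polyb (fun x => a (prow w x)).
Proof.
move=> ca aB; apply: (polyb_le _ (polyb_cst n B)).
- by apply: measurable_row => // b; case: (polyb_peval (w b)).
- by move=> x; rewrite (le_trans (aB _))// ler_norm.
Qed.

Lemma prow_derive n a (w : 'I_r -> mpoly n R) x j (t : R) : C1 a ->
  is_derive t 1 (fun s : R => a (prow w (tset x j s)))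
    (\sum_(b < r) peval (mderiv j (w b)) (tset x j t) * partial b a (prow w (tset x j t))).
Proof.
move=> C1a.
exact: (chain_rule_C1 C1a (fun b => peval_derive (w b) x j t)).
Qed.

(** The counterpart of [numop_ibp] for a non-polynomial test function: the second derivative of [u]
    cancels again, and the chain rule differentiates h(w). *)
Lemma expect_numop n h (B : R) (u : mpoly n R) (w : 'I_r -> mpoly n R) : C1 h ->
  (forall b x, `|partial b h x| <= B) ->
  expect (fun x => peval (numop u) x * h (prow w x)) =
  expect (fun x => \sum_(b < r) peval (grad_dot u (w b)) x * partial b h (prow w x)).
Proof.
move=> C1h hB; have [ch dh cph] := C1h.
have ph := polyb_C1 w C1h hB.
have pph b := polyb_bounded w (cph b) (hB b).
pose g' j x := peval (mderiv j (mderiv j u)) x * h (prow w x).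
pose g'' j x := peval (mderiv j u) x *
  \sum_(b < r) peval (mderiv j (w b)) x * partial b h (prow w x).
have pg' j : polyb (g' j) by apply: polybM => //; exact: polyb_peval.
have pg'' j : polyb (g'' j).
  apply: polybM; first exact: polyb_peval.
  by apply: polyb_sum => b; apply: polybM => //; exact: polyb_peval.
have pg j : polyb (fun x => peval (mderiv j u) x * h (prow w x)).
  by apply: polybM => //; exact: polyb_peval.
have ibp j : expect (fun x => tnth x j * (peval (mderiv j u) x * h (prow w x))) =
    expect (g' j) + expect (g'' j).
  rewrite -expectD//; apply: expect_ibp => //; first exact: polybD.
  - move=> x t; apply: (is_derive_eq (is_deriveM (peval_derive (mderiv j u) x j t)
      (prow_derive w x j t C1h))).
    by rewrite /g' /g'' -![_ *: _]/(_ * _) addrC mulrC.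
  - move=> x; have cw (p : mpoly n R) := @continuous_peval_tset R n p x j.
    have crow a : continuous a -> continuous (fun s : R => a (prow w (tset x j s))).
      by move=> ca; apply: (continuous_row ca) => b; exact: cw.
    move=> t; apply: cvgD; apply: cvgM; [exact: cw|exact: crow|exact: cw|].
    apply: (cvg_big (op := +%R)) => [|b _]; first exact: add_continuous.
    by apply: cvgM; [exact: cw | exact: crow].
transitivity (\sum_(j < n) (expect (fun x => tnth x j * (peval (mderiv j u) x * h (prow w x))) -
    expect (g' j))).
  under eq_bigr => j _.
    rewrite -expectB//; last by apply: polybM => //; exact: polyb_tnth.
    over.
  rewrite -expect_sum; last first.
    move=> j; apply: polybD; last exact: polybN.
    by apply: polybM => //; exact: polyb_tnth.
  apply: eq_Rintegral => x _; rewrite /peval /numop linear_sum mulr_suml.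
  apply: eq_bigr => j _ /=.
  by rewrite mevalB mevalM mevalXU mulrBl mulrA.
under eq_bigr => j _ do rewrite ibp addrAC subrr add0r.
rewrite -expect_sum//; apply: eq_Rintegral => x _.
under eq_bigr => j _ do rewrite /g'' mulr_sumr.
rewrite exchange_big /=; apply: eq_bigr => b _.
rewrite /peval /grad_dot linear_sum mulr_suml; apply: eq_bigr => j _ /=.
by rewrite mevalM mulrA.
Qed.

End SmoothFunctionsOfPolynomials.

(** * Interpolation *)

Section GradDotBilinear.
Context {R : realFieldType} {n : nat}.
Implicit Types p q s : mpoly n R.

Lemma grad_dotC p q : grad_dot p q = grad_dot q p.
Proof. by apply: eq_bigr => j _; rewrite mulrC. Qed.

Lemma grad_dotPl c p q s : grad_dot (c *: p + q) s = c *: grad_dot p s + grad_dot q s.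
Proof.
rewrite /grad_dot scaler_sumr -big_split; apply: eq_bigr => j _ /=.
by rewrite linearP /= mulrDl scalerAl.
Qed.

Lemma grad_dotZl c p q : grad_dot (c *: p) q = c *: grad_dot p q.
Proof.
rewrite /grad_dot scaler_sumr; apply: eq_bigr => j _ /=.
by rewrite linearZ /= scalerAl.
Qed.

End GradDotBilinear.

Section Interpolation.
Context {R : realType} {r N : nat}.
Variables (alpha : 'rV[R]_r -> R) (M : R).
Hypothesis alphaC2 : C2 alpha.
Hypothesis alphaM : forall i j x, `|partial i (partial j alpha) x| <= M.
Local Notation poly := (mpoly N R).
Local Notation grad := (fun a => partial a alpha).

Let alphaC1 : C1 alpha. Proof. by case: alphaC2. Qed.
Let gradC1 a : C1 (grad a). Proof. by case: alphaC2. Qed.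

Lemma grad_growth a (v : 'rV[R]_r) :
  `|grad a v| <= `|grad a 0| + M * \sum_(b < r) `|v 0 b|.
Proof. by apply: C1_growth => // b s _; exact: alphaM. Qed.

Lemma polyb_grad (w : 'I_r -> poly) a : polyb (fun x => grad a (prow w x)).
Proof. by apply: (@polyb_C1 _ _ _ _ M) => // b x; exact: alphaM. Qed.

Lemma polyb_hess (w : 'I_r -> poly) a b :
  polyb (fun x => partial b (grad a) (prow w x)).
Proof. by apply: (@polyb_bounded _ _ _ _ M) => //; have [_ _] := gradC1 a. Qed.

(** Bounded second derivatives make the gradient grow at most linearly and [alpha] at most
    quadratically. *)
Lemma polyb_C2 (w : 'I_r -> poly) : polyb (fun x => alpha (prow w x)).
Proof.
pose S x := \sum_(b < r) `|peval (w b) x|.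
pose B x := \sum_(a < r) `|grad a 0| + `|M| * S x.
have pS : polyb S by apply: polyb_sum => b; apply: polyb_norm; exact: polyb_peval.
apply: (@polyb_le _ _ _ (fun x => `|alpha 0| + B x * S x)).
- by apply: measurable_row => [|b]; [case: alphaC1 | case: (polyb_peval (w b))].
- apply: polybD; first exact: polyb_cst.
  apply: polybM => //; apply: polybD; first exact: polyb_cst.
  by apply: polybM => //; exact: polyb_cst.
- move=> x; apply: le_trans (ler_norm _).
  have -> : S x = \sum_(b < r) `|prow w x 0 b| by apply: eq_bigr => b _; rewrite mxE.
  apply: C1_growth => // b s /andP[s0 s1]; apply: (le_trans (grad_growth _ _)).
  apply: lerD; first by rewrite (bigD1 b) //= lerDl sumr_ge0.
  rewrite (le_trans (ler_wpM2r _ (ler_norm M)))// ?sumr_ge0//.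
  rewrite ler_wpM2l//; apply: ler_sum => c _; rewrite !mxE normrM.
  by rewrite ler_piMl// ger0_norm.
Qed.

Variables (f g uf ug : 'I_r -> poly).
Hypothesis fE : forall a, f a = numop (uf a).
Hypothesis gE : forall a, g a = numop (ug a).
Hypothesis uf_g : forall a b, grad_dot (uf a) (g b) = 0.
Hypothesis ug_f : forall a b, grad_dot (ug a) (f b) = 0.

Let W (th : R) a : poly := sin th *: f a + cos th *: g a.

Let W' (th : R) a : poly := cos th *: f a - sin th *: g a.

Let psi (th : R) : R := expect (fun x => alpha (prow (W th) x)).

Let defect : R := \sum_(a < r) \sum_(b < r)
  expect (fun x => `|peval (grad_dot (uf a) (f b) - grad_dot (ug a) (g b)) x|).

Let dpsi (th : R) : R :=
  expect (fun x => \sum_(a < r) peval (W' th a) x * grad a (prow (W th) x)).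

Let pevalZ (c : R) (p : poly) x : peval (c *: p) x = c * peval p x.
Proof. exact: mevalZ. Qed.

Let pevalD (p q : poly) x : peval (p + q) x = peval p x + peval q x.
Proof. exact: mevalD. Qed.

Lemma path_derive x (th : R) : is_derive th 1 (fun s : R => alpha (prow (W s) x))
  (\sum_(a < r) peval (W' th a) x * grad a (prow (W th) x)).
Proof.
apply: (chain_rule_C1 alphaC1) => a.
have e : (fun s : R => peval (W s a) x) =
    (fun s => sin s * peval (f a) x + cos s * peval (g a) x).
  by apply/funext => s; rewrite /W pevalD !pevalZ.
rewrite e.
apply: (is_derive_eq (is_deriveD
  (is_deriveM (is_derive_sin th) (is_derive_cst (peval (f a) x) th 1))
  (is_deriveM (is_derive_cos th) (is_derive_cst (peval (g a) x) th 1)))).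
rewrite /W' -scaleNr pevalD !pevalZ !scaler0 !add0r.
by rewrite -![_ *: _]/(_ * _) mulrC [X in _ + X]mulrC.
Qed.

(** Differentiation under the integral sign. As |sin| and |cos| are at most 1, the single function
    [G] dominates the derivative for all angles. *)
Lemma psi_derive (th : R) : is_derive th 1 psi (dpsi th).
Proof.
pose S x := \sum_(b < r) (`|peval (f b) x| + `|peval (g b) x|).
pose G x := \sum_(a < r) (`|peval (f a) x| + `|peval (g a) x|) * (`|grad a 0| + `|M| * S x).
have pfg a : polyb (fun x => `|peval (f a) x| + `|peval (g a) x|).
  by apply: polybD; apply: polyb_norm; exact: polyb_peval.
have pS : polyb S by exact: polyb_sum.
have pG : polyb G.
  apply: polyb_sum => a; apply: polybM => //; apply: polybD; first exact: polyb_cst.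
  by apply: polybM => //; exact: polyb_cst.
have S0 x : 0 <= S x by apply: sumr_ge0 => b _; rewrite addr_ge0.
have G0 x : 0 <= G x.
  by apply: sumr_ge0 => a _; rewrite mulr_ge0 ?addr_ge0// mulr_ge0.
have sin1 s : `|sin s| <= 1 :> R by rewrite ler_norml sin_geN1 sin_le1.
have cos1 s : `|cos s| <= 1 :> R by rewrite ler_norml cos_geN1 cos_le1.
have comb (c c' y y' : R) : `|c| <= 1 -> `|c'| <= 1 -> `|c * y + c' * y'| <= `|y| + `|y'|.
  by move=> c1 c1'; rewrite (le_trans (ler_normD _ _))// !normrM lerD// ler_piMl.
have dpath y (s : R) : partial1of2 (fun s x => alpha (prow (W s) x)) s y =
    \sum_(a < r) peval (W' s a) y * grad a (prow (W s) y).
  by rewrite partial1of2E; have ? := path_derive y s; rewrite derive_val.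
have bd (s : R) y : `|partial1of2 (fun s x => alpha (prow (W s) x)) s y| <= G y.
  rewrite dpath (le_trans (ler_norm_sum _ _ _))//; apply: ler_sum => a _.
  rewrite normrM ler_pM//.
    by rewrite /W' -scaleNr pevalD !pevalZ comb// normrN.
  rewrite (le_trans (grad_growth _ _))// lerD2l.
  rewrite (le_trans (ler_wpM2r _ (ler_norm M)))// ?sumr_ge0// ler_wpM2l//.
  by apply: ler_sum => b _; rewrite mxE /W pevalD !pevalZ comb.
have I : `](th - 1), (th + 1)[%classic th.
  by rewrite /= in_itv/= ltrBlDr !ltrDl ltr01.
have i1 (s : R) : `](th - 1), (th + 1)[%classic s ->
    (gauss N).-integrable setT (EFin \o (fun x => alpha (prow (W s) x))).
  by move=> _; apply: polyb_integrable; exact: polyb_C2.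
have i2 (s : R) y : `](th - 1), (th + 1)[%classic s -> setT y ->
    derivable ((fun s x => alpha (prow (W s) x)) ^~ y) s 1.
  by move=> _ _; have [] := path_derive y s.
have H := derivable_under_integral measurableT I i1 i2 G0 (polyb_integrable pG) (fun s y _ _ => bd s y).
have H' := differentiation_under_integral measurableT I i1 i2 G0 (polyb_integrable pG) (fun s y _ _ => bd s y).
apply: DeriveDef; first exact: H.
rewrite -derive1E [LHS]H' /dpsi /expect.
by apply: eq_Rintegral => x _; rewrite -dpath.
Qed.

(** The velocity [W'] is [numop] of the rotated preimage [V]. In the gradient product of [V] and [W]
    the mixed terms vanish, and the other two carry sin cos and - sin cos, so that the covariances
    of [f] and [g] compete. *)
Lemma dpsiE (th : R) : dpsi th = sin th * cos th * \sum_(a < r) \sum_(b < r)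
  expect (fun x => peval (grad_dot (uf a) (f b) - grad_dot (ug a) (g b)) x *
    partial b (grad a) (prow (W th) x)).
Proof.
have pH a b := polyb_hess (W th) a b.
have pP (p : poly) := polyb_peval p.
pose V a : poly := cos th *: uf a - sin th *: ug a.
have WV a : W' th a = numop (V a) by rewrite /V /W' fE gE linearB !linearZ.
have VW a b : grad_dot (V a) (W th b) =
    (sin th * cos th) *: (grad_dot (uf a) (f b) - grad_dot (ug a) (g b)).
  rewrite /V /W -scaleNr grad_dotPl grad_dotZl !(grad_dotC _ (_ + _)) !grad_dotPl !grad_dotZl.
  rewrite !(grad_dotC (f b)) !(grad_dotC (g b)) uf_g ug_f !scaler0 addr0 add0r.
  by rewrite scalerBr !scalerA mulNr scaleNr [cos th * _]mulrC.
rewrite /dpsi expect_sum; last first.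
  by move=> a; apply: polybM => //; exact: polyb_grad.
rewrite mulr_sumr; apply: eq_bigr => a _.
rewrite WV (@expect_numop _ _ _ _ M)//.
rewrite expect_sum; last by move=> b; exact: polybM.
rewrite mulr_sumr; apply: eq_bigr => b _.
rewrite -expectZ; last exact: polybM.
by apply: eq_Rintegral => x _; rewrite VW pevalZ mulrA.
Qed.

Lemma dpsi_le (th : R) : `|dpsi th| <= 2^-1 * (M * defect).
Proof.
have pH a b := polyb_hess (W th) a b.
have pP (p : poly) := polyb_peval p.
have sc : `|sin th * cos th| <= 2^-1.
  have := sin2cos2 th; have := sqr_ge0 (sin th - cos th).
  have := sqr_ge0 (sin th + cos th).
  rewrite ler_norml sqrrD sqrrB => h1 h2 h3; apply/andP; split; lra.
rewrite dpsiE normrM ler_pM//.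
rewrite (le_trans (ler_norm_sum _ _ _))// mulr_sumr; apply: ler_sum => a _.
rewrite (le_trans (ler_norm_sum _ _ _))// mulr_sumr; apply: ler_sum => b _.
apply: (le_trans (expect_norm_le _)); first exact: polybM.
rewrite -expectZ; last exact: polyb_norm.
apply: le_expect; first by apply: polyb_norm; exact: polybM.
  by apply: polybM; [exact: polyb_cst | exact: polyb_norm].
by move=> x; rewrite normrM mulrC ler_wpM2r// alphaM.
Qed.

Lemma interpolation :
  `|expect (fun x => alpha (prow f x)) - expect (fun x => alpha (prow g x))| <= M * defect.
Proof.
have cpsi : continuous psi.
  by move=> u; apply/differentiable_continuous/derivable1_diffP; have [] := psi_derive u.
have pih : 0 < pi / 2 :> R by have /andP[] := pihalf_02 R.
have psi1 : psi (pi / 2) = expect (fun x => alpha (prow f x)).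
  rewrite /psi; congr expect; apply/funext => x; congr (alpha _).
  by apply/rowP => b; rewrite !mxE /W sin_pihalf cos_pihalf scale1r scale0r addr0.
have psi0 : psi 0 = expect (fun x => alpha (prow g x)).
  rewrite /psi; congr expect; apply/funext => x; congr (alpha _).
  by apply/rowP => b; rewrite !mxE /W sin0 cos0 scale1r scale0r add0r.
(* The path has length pi/2 < 2 and the derivative carries the factor 1/2, so no constant
   survives. *)
have [c _] := @MVT _ psi dpsi _ _ pih (fun u _ => psi_derive u) (continuous_subspaceT cpsi).
rewrite psi1 psi0 subr0 => ->; rewrite normrM (gtr0_norm pih).
have d0 : 0 <= M * defect.
  by have := le_trans (normr_ge0 _) (dpsi_le 0); rewrite pmulr_rge0.
rewrite -[leRHS]mul1r -[X in X * (M * _)](mulVf (_ : 2 != 0 :> R))// mulrAC.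
by rewrite ler_pM// ?dpsi_le// ltW// pihalf_lt2.
Qed.

End Interpolation.

(** * Gaussian vectors and the invariance principle *)

Section Reindexing.
Context {R : realType} {n N : nat} (sigma : 'I_n -> 'I_N).
Hypothesis sigma_inj : injective sigma.
Local Notation var i := (mpolyX R (mnm1 i)).
Implicit Types p q : mpoly n R.

(** Substituting variables along an injection places polynomials on a chosen block of coordinates of
    a larger Gaussian space. *)
Definition relabel (p : mpoly n R) : mpoly N R :=
  comp_mpoly [tuple var (sigma i) | i < n] p.

Definition subtuple (x : N.-tuple R) : n.-tuple R := [tuple tnth x (sigma i) | i < n].

Lemma peval_relabel p x : peval (relabel p) x = peval p (subtuple x).
Proof.
rewrite /peval /relabel comp_mpoly_meval; apply: meval_eq => i.
by rewrite !tnth_mktuple mevalXU.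
Qed.

Lemma relabel_var i : relabel (var i) = var (sigma i).
Proof. by rewrite /relabel comp_mpolyXU (nth_mktuple _ _ i). Qed.

Lemma relabelD p q : relabel (p + q) = relabel p + relabel q.
Proof. exact: comp_mpolyD. Qed.

Lemma relabelM p q : relabel (p * q) = relabel p * relabel q.
Proof. exact: rmorphM. Qed.

Lemma relabelB p q : relabel (p - q) = relabel p - relabel q.
Proof. exact: comp_mpolyB. Qed.

Lemma relabel_sum (I : Type) (r : seq I) (F : I -> mpoly n R) :
  relabel (\sum_(i <- r) F i) = \sum_(i <- r) relabel (F i).
Proof. exact: linear_sum. Qed.

Lemma relabelC c : relabel (mpolyC n c) = mpolyC N c.
Proof. exact: comp_mpolyC. Qed.

Lemma mderiv_relabel i p : mderiv (sigma i) (relabel p) = relabel (mderiv i p).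
Proof.
move: p; apply: mpoly_alg_ind => [c|p q ip iq|j p ip].
- by rewrite relabelC !mderivC [RHS]comp_mpoly0.
- by rewrite relabelD !mderivD ip iq relabelD.
- rewrite relabelM !mderivM ip relabelD !relabelM relabel_var !mderiv_var (inj_eq sigma_inj).
  congr (_ * _ + _); case: (i == j); last by rewrite [RHS]comp_mpoly0.
  by rewrite [RHS]comp_mpoly1.
Qed.

Lemma mderiv_relabel_out l p : l \notin codom sigma -> mderiv l (relabel p) = 0.
Proof.
move=> lN; move: p; apply: mpoly_alg_ind => [c|p q ip iq|j p ip].
- by rewrite relabelC mderivC.
- by rewrite relabelD mderivD ip iq addr0.
- rewrite relabelM mderivM ip mulr0 addr0 relabel_var mderiv_var.
  rewrite (_ : (l == sigma j) = false) ?mul0r//; apply: contraNF lN => /eqP->.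
  exact: codom_f.
Qed.

Lemma sum_codom (V : zmodType) (F : 'I_N -> V) :
  (forall l, l \notin codom sigma -> F l = 0) -> \sum_l F l = \sum_i F (sigma i).
Proof.
move=> F0; rewrite (bigID (mem (codom sigma))) /= [X in _ + X]big1 // addr0.
have uc : uniq (codom sigma) by rewrite map_inj_uniq ?enum_uniq.
by rewrite -(big_uniq _ uc) codomE big_map big_enum.
Qed.

Lemma numop_relabel p : numop (relabel p) = relabel (numop p).
Proof.
rewrite /numop sum_codom => [|l lN]; last by rewrite mderiv_relabel_out// mulr0 linear0 subr0.
rewrite relabel_sum; apply: eq_bigr => i _.
by rewrite relabelB relabelM relabel_var !mderiv_relabel.
Qed.

Lemma grad_dot_relabel p q : grad_dot (relabel p) (relabel q) = relabel (grad_dot p q).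
Proof.
rewrite /grad_dot sum_codom => [|l lN]; last by rewrite mderiv_relabel_out// mul0r.
by rewrite relabel_sum; apply: eq_bigr => i _; rewrite relabelM !mderiv_relabel.
Qed.

End Reindexing.

Lemma grad_dot_relabel_disjoint {R : realType} n k N (s : 'I_n -> 'I_N) (t : 'I_k -> 'I_N)
    (p : mpoly n R) (q : mpoly k R) : (forall i j, s i != t j) ->
  grad_dot (relabel s p) (relabel t q) = 0.
Proof.
move=> st; apply: big1 => l _.
have [/codomP[i ->]|lN] := boolP (l \in codom s); last first.
  by rewrite mderiv_relabel_out// mul0r.
rewrite [mderiv _ (relabel t q)]mderiv_relabel_out ?mulr0//.
by apply/codomP => -[j e]; have := st i j; rewrite e eqxx.
Qed.

Section Marginals.
Context {R : realType}.
Local Notation gauss n := (@gauss R n).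

Lemma gauss_marginal_lshift n k (f : n.-tuple R -> R) :
  polyb f -> polyb (f \o subtuple (@lshift n k)) ->
  (\int[gauss (n + k)]_x (f (subtuple (@lshift n k) x))%:E = \int[gauss n]_x (f x)%:E)%E.
Proof.
elim: n f => [|n IH] f pf pf'.
  have e0 m (g : m.-tuple R -> 0.-tuple R) :
      (\int[gauss m]_x (f (g x))%:E = (f [tuple])%:E)%E.
    under eq_integral => x _ do rewrite [g x]tuple0.
    by rewrite integral_cst//= probability_setT mule1.
  by rewrite e0 (e0 0%N id).
have sub_cons (t : R) (x : (n + k).-tuple R) : subtuple (@lshift n.+1 k) (tuple_cons (t, x)) =
    tuple_cons (t, subtuple (@lshift n k) x).
  apply: eq_from_tnth => i; rewrite tnth_mktuple.
  case: (unliftP ord0 i) => [j ->|->]; last by rewrite /tnth.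
  rewrite [lshift k _](_ : _ = lift ord0 (lshift k j)); last exact: val_inj.
  by rewrite !tnthS tnth_mktuple.
rewrite (@integral_gaussS _ (n + k) (f \o subtuple (@lshift n.+1 k)))// integral_gaussS//.
apply: eq_integral => t _; rewrite -IH.
- by apply: eq_integral => x _; rewrite /= sub_cons.
- exact: polyb_cons.
- have := @polyb_cons _ (n + k) _ t pf'; rewrite /comp.
  by under eq_fun do rewrite sub_cons.
Qed.

(** The leading coordinates are integrated out one by one; the growth condition ranges over all [m]
    to serve each stage of this induction. *)
Lemma gauss_marginal_rshift n k (f : k.-tuple R -> R) :
  polyb f -> (forall m, polyb (f \o subtuple (@rshift m k))) ->
  (\int[gauss (n + k)]_x (f (subtuple (@rshift n k) x))%:E = \int[gauss k]_x (f x)%:E)%E.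
Proof.
move=> pf pf'; elim: n => [|n IH].
  apply: eq_integral => x _; congr (f _)%:E; apply: eq_from_tnth => i.
  by rewrite tnth_mktuple; congr tnth; exact: val_inj.
have sub_cons (t : R) (x : (n + k).-tuple R) : subtuple (@rshift n.+1 k) (tuple_cons (t, x)) =
    subtuple (@rshift n k) x.
  apply: eq_from_tnth => i; rewrite !tnth_mktuple.
  rewrite [rshift n.+1 _](_ : _ = lift ord0 (rshift n i)); last exact: val_inj.
  by rewrite tnthS.
have pf1 : @polyb R (n + k).+1 (f \o subtuple (@rshift n.+1 k)) := pf' n.+1.
rewrite (integral_gaussS pf1).
under eq_integral => t _.
  under eq_integral => x _ do rewrite /= sub_cons.
  rewrite IH (expectE pf); over.
by rewrite integral_cst//= probability_setT mule1 (expectE pf).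
Qed.

End Marginals.

Section FiniteMoments.
Context {R : realType}.

(** Integrate |f| <= f^2 / (2 s) + s / 2. Taking s = B + e with e > 0 avoids division by zero when B
    = 0. *)
Lemma expect_norm_le_sqrt n (f : n.-tuple R -> R) (B : R) : polyb f -> 0 <= B ->
  expect (fun x => f x ^+ 2) <= B ^+ 2 -> expect (fun x => `|f x|) <= B.
Proof.
move=> pf B0 fB; apply/ler_addgt0Pr => e e0; set s := B + e.
have s0 : 0 < s by rewrite ltr_wpDl.
have pf2 : polyb (fun x => f x ^+ 2) by exact: polybM.
have pZ : polyb (fun x => (2 * s)^-1 * f x ^+ 2) by apply: polybM => //; exact: polyb_cst.
apply: (@le_trans _ _ (expect (fun x => (2 * s)^-1 * f x ^+ 2 + s / 2))).
  apply: le_expect => [||x]; [exact: polyb_norm | exact: polybD (polyb_cst _ _) |].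
  have -> : (2 * s)^-1 * f x ^+ 2 + s / 2 = ((f x ^+ 2) + s ^+ 2) / (2 * s) by field; rewrite gt_eqF.
  rewrite ler_pdivlMr ?mulr_gt0// -(real_normK (num_real (f x))).
  have := sqr_ge0 (`|f x| - s); rewrite sqrrB; lra.
rewrite expectD ?expect_cst ?expectZ//; last exact: polyb_cst.
apply: (@le_trans _ _ ((2 * s)^-1 * s ^+ 2 + s / 2)).
  rewrite lerD2r ler_wpM2l ?invr_ge0 ?mulr_ge0 ?(ltW s0)// (le_trans fB)//.
  by rewrite ler_pXn2r ?nnegrE ?(ltW s0)// lerDl ltW.
by rewrite le_eqVlt; apply/orP; left; apply/eqP; field; rewrite gt_eqF.
Qed.

Lemma expectation_gauss n (f : n.-tuple R -> R) : polyb f ->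
  ('E_(std_gaussian n)[f] = (expect f)%:E)%E.
Proof. by move=> pf; rewrite expectation.unlock; exact: expectE. Qed.

Lemma centered_covariance d (T : measurableType d) (P : probability T R) (X Y : T -> R) :
  ('E_P[X] = 0)%E -> ('E_P[Y] = 0)%E -> covariance P X Y = ('E_P[(fun w => X w * Y w)%R])%E.
Proof.
move=> X0 Y0; rewrite covariance.unlock X0 Y0; congr expectation.
by apply/funext => w; rewrite -[LHS]/((X w - 0) * (Y w - 0)) !subr0.
Qed.

Lemma peval_mul n (p q : mpoly n R) : peval (p * q) = (fun x => peval p x * peval q x).
Proof. by apply/funext => x; exact: mevalM. Qed.

Definition chaos_constant (d : nat) : nat := (d ^ (5 * d))%N.

(** The factor d!^3 collects d!^2 from the operator norms and d! from the Hilbert-Schmidt norms. As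
    2 <= d and d! <= d^d, the left side is at most d^(7d + 4), and 7d + 4 <= 10d. *)
Lemma chaos_constant_le d : (2 <= d)%N ->
  (d.*2 * (2 ^ d.*2 * d) ^ 2 * d`! ^ 3 <= chaos_constant d ^ 2)%N.
Proof.
move=> d2; have d0 : (0 < d)%N by exact: leq_trans d2.
have fd : (d`! <= d ^ d)%N.
  apply: (@leq_trans (\prod_(1 <= i < d.+1) d)%N).
    by rewrite fact_prod !big_nat; apply: leq_prod => i /andP[_]; rewrite ltnS.
  by rewrite prod_nat_const_nat subSS subn0.
rewrite /chaos_constant -expnM expnMn -expnM mulnA.
have e1 : (d.*2 <= d ^ 2)%N by rewrite -mul2n -mulnn leq_mul2r d2 orbT.
have e2 : (2 ^ (d.*2 * 2) <= d ^ (d.*2 * 2))%N by rewrite leq_exp2r// muln_gt0 double_gt0 d0.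
have e3 : (d`! ^ 3 <= d ^ (d * 3))%N by rewrite expnM leq_exp2r.
apply: (@leq_trans (d ^ 2 * d ^ (d.*2 * 2) * d ^ 2 * d ^ (d * 3))%N).
  by rewrite !leq_mul.
rewrite -!expnD leq_exp2l//.
by lia.
Qed.

Lemma eigenregular_mpoly n d (eps : R) (F : mpoly n R) : eigenregular d eps F ->
  ('E_(std_gaussian n)[peval F] = 0)%E ->
  (variance (std_gaussian n) (peval F) <= 1)%E ->
  exists p u : mpoly n R, let c := ecoef (@mexpect R n) in
    [/\ peval p = peval F, p = numop u,
      0 <= eps /\ forall s, (d < size s)%N -> c p s = 0 /\ c u s = 0,
      contracts (c p) (d`!%:R ^+ 2 * eps) /\ contracts (c u) (d`!%:R ^+ 2 * eps) &
      forall q, seqsum q (fun s => c p s ^+ 2) <= d`!%:R /\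
                seqsum q (fun s => c u s ^+ 2) <= d`!%:R].
Proof.
move=> [f [fF lameps]] F0 F1.
have [p [u [pF pf pd up [c pu]]]] := chaos_polynomials (@mexpect1 R n) (@mexpect_ibp R n) fF.
have {}pF : peval p = peval F by apply/funext.
have p0 : mexpect p = 0.
  by move: F0; rewrite -pF expectation_gauss; [case|exact: polyb_peval].
(* [numop u] has mean zero, by integration by parts against 1, so [c] is the mean of F. *)
have c0 : c = 0.
  move: p0; rewrite pu linearD linearZ /= mexpect1 mulr1.
  have := numop_ibp (@mexpect_ibp R n) u 1; rewrite mulr1 => ->.
  rewrite /grad_dot big1 ?linear0 ?add0r// => j _.
  by rewrite -mpolyC1 mderivC mulr0.
have V : variance (std_gaussian n) (peval F) = (mexpect (p * p))%:E.
  rewrite /variance centered_covariance// -pF -peval_mul expectation_gauss//.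
  exact: polyb_peval.
have V1 : mexpect (p * p) <= 1 by rewrite -lee_fin -V.
rewrite V in lameps.
have [eps0 cp cu np nu] := chaos_bounds (@mexpect1 R n) (@mexpect_ibp R n) pf pd up V1 lameps.
exists p, u; split=> //; first by rewrite pu c0 scale0r addr0.
by split=> // s ds; rewrite up pd ?mulr0.
Qed.

Lemma expect_grad_dot_le n d (eps : R) (p u : mpoly n R) (C : R) :
  let c := ecoef (@mexpect R n) in
  (2 <= d)%N -> 0 <= eps ->
  (forall s, (d < size s)%N -> c p s = 0) -> (forall s, (d < size s)%N -> c u s = 0) ->
  contracts (c p) (d`!%:R ^+ 2 * eps) -> contracts (c u) (d`!%:R ^+ 2 * eps) ->
  (forall q, seqsum q (fun s => c p s ^+ 2) <= d`!%:R) ->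
  (forall q, seqsum q (fun s => c u s ^+ 2) <= d`!%:R) ->
  mexpect (grad_dot u p) = C ->
  expect (fun x => `|peval (grad_dot u p) x - C|) <= (chaos_constant d)%:R * Num.sqrt eps.
Proof.
move=> c d2 eps0 pd ud cp cu np nu yC.
have py := polyb_peval (grad_dot u p).
apply: expect_norm_le_sqrt.
- exact: polybD py (polyb_cst _ _).
- by rewrite mulr_ge0// sqrtr_ge0.
rewrite exprMn sqr_sqrtr//.
have -> : expect (fun x => (peval (grad_dot u p) x - C) ^+ 2) =
    mexpect (grad_dot u p * grad_dot u p) - mexpect (grad_dot u p) ^+ 2.
  rewrite yC; have -> : mexpect (grad_dot u p * grad_dot u p) - C ^+ 2 =
    mexpect (grad_dot u p * grad_dot u p - (2 * C) *: grad_dot u p + C ^+ 2 *: 1).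
    rewrite linearD linearB !linearZ /= mexpect1 yC -![_ *: _]/(_ * _); ring.
  apply: eq_Rintegral => x _.
  by rewrite /peval mevalD mevalB !mevalZ mevalM meval1; ring.
have L0 : 0 <= d`!%:R ^+ 2 * eps by rewrite mulr_ge0// sqr_ge0.
have B0 : 0 <= d`!%:R :> R by [].
apply: (le_trans (variance_grad_dot (@mexpect1 R n) (@mexpect_ibp R n) L0 B0 ud pd cu cp nu np)).
rewrite (_ : _ * (_ * _) = (d.*2 * (2 ^ d.*2 * d) ^ 2 * d`! ^ 3)%:R * eps).
  by rewrite ler_wpM2r// -natrX ler_nat chaos_constant_le.
by rewrite (natrM _ _ (d`! ^ 3)) natrX; ring.
Qed.

End FiniteMoments.

Section GaussianVectors.
Context {R : realType} {r k : nat} (A : 'M[R]_(r, k)) (m : 'I_r -> R).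

Definition affine_tuple (z : k.-tuple R) : r.-tuple R :=
  [tuple m i + \sum_(j < k) A i j * tnth z j | i < r].

Lemma measurable_affine_tuple : measurable_fun setT affine_tuple.
Proof.
apply/measurable_fun_tnthP => i.
rewrite (_ : _ \o _ = fun z => m i + \sum_(j < k) A i j * tnth z j); last first.
  by apply/funext => z; rewrite /= tnth_mktuple.
apply: measurable_funD => //; apply: measurable_sum => j.
by apply: measurable_funM => //; exact: measurable_tnth.
Qed.

HB.instance Definition _ := isMeasurableFun.Build _ _ _ _ affine_tuple
  measurable_affine_tuple.

Lemma expectation_gaussian_law d (T : measurableType d) (Q : probability T R)
    (G : {RV Q >-> r.-tuple R}) (f : r.-tuple R -> R) :
  (forall B : set (r.-tuple R), measurable B ->
     distribution Q G B = std_gaussian k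
       [set z | B [tuple m i + \sum_(j < k) A i j * tnth z j | i < r]]) ->
  measurable_fun setT f -> polyb (f \o affine_tuple) ->
  ('E_Q[(fun w => f (G w))] = (expect (f \o affine_tuple))%:E)%E.
Proof.
move=> law mf pf.
have mEf : measurable_fun setT (EFin \o f) by exact/measurable_EFinP.
have lawE (g : r.-tuple R -> \bar R) :
    (\int[distribution Q G]_y g y = \int[distribution (gauss k) affine_tuple]_y g y)%E.
  by apply: eq_measure_integral => B mB _; exact: law.
have iQ : Q.-integrable setT (EFin \o f \o G).
  apply/integrableP; split; first exact: measurableT_comp.
  rewrite -(ge0_integral_distribution G (f := fun y => `|(f y)%:E|%E))//; last first.
    exact: measurableT_comp.
  rewrite lawE ge0_integral_distribution//; last exact: measurableT_comp.
  by have /integrableP[] := polyb_integrable pf.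
rewrite expectation.unlock -(integral_distribution mEf iQ) lawE.
rewrite integral_distribution//; last exact: polyb_integrable.
exact: expectE.
Qed.

End GaussianVectors.

Section LinearForms.
Context {R : realType} {n : nat}.
Implicit Types h : 'I_n -> R.

(** Linear forms lie in the first chaos, so in the interpolation the Gaussian side is its own
    preimage under [numop]. *)
Lemma numop_linform h : numop (linform h) = linform h.
Proof.
rewrite /numop; apply: eq_bigr => j _.
by rewrite mderiv_linform linearZ /= -mpolyC1 mderivC scaler0 subr0 -scalerAr mpolyC1 mulr1.
Qed.

Lemma mexpect_linform h : mexpect (linform h) = 0.
Proof.
rewrite -[linform h]mulr1 -{1}numop_linform (numop_ibp (@mexpect_ibp R n)).
by rewrite /grad_dot big1 ?linear0// => j _; rewrite -mpolyC1 mderivC mulr0.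
Qed.

Lemma grad_dot_linform h h' :
  grad_dot (linform h) (linform h') = (\sum_(j < n) h j * h' j) *: 1.
Proof.
rewrite /grad_dot scaler_suml; apply: eq_bigr => j _.
by rewrite !mderiv_linform -scalerAl mul1r scalerA.
Qed.

Lemma mexpect_linformM h h' :
  mexpect (linform h * linform h') = \sum_(j < n) h j * h' j.
Proof.
rewrite -{1}numop_linform (numop_ibp (@mexpect_ibp R n)) grad_dot_linform.
by rewrite linearZ /= mexpect1 mulr1.
Qed.

End LinearForms.

(** The division by ln 2 changes the base: 2^(5 d log_2 d) = d^(5d). *)
Lemma chaos_constantE (R : realType) (d : nat) : (2 <= d)%N ->
  2 `^ (5 / ln 2 * d%:R * ln d%:R) = (chaos_constant d)%:R :> R.
Proof.
move=> d2; have d0 : 0 < d%:R :> R by rewrite ltr0n (leq_trans _ d2).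
have l2 : ln 2 != 0 :> R by rewrite gt_eqF// ln_gt0// ltr1n.
rewrite /powR pnatr_eq0 /= /chaos_constant natrX.
rewrite (_ : _ * ln 2 = (5 * d)%:R * ln d%:R); last by rewrite natrM; field.
by rewrite expRM_natl lnK// posrE.
Qed.

Theorem theorem19 (R : realType) :
  exists K : R,
  forall (d n r : nat) (eps : R) (F : 'I_r -> mpoly n R) (C : 'M[R]_r),
    (2 <= d)%N ->
    (forall i, (msize (F i) <= d.+1)%N) ->
    (forall i, 'E_(std_gaussian n)[peval (F i)] = 0)%E ->
    (forall i, variance (std_gaussian n) (peval (F i)) <= 1)%E ->
    (forall i, eigenregular d eps (F i)) ->
    (forall i j, (C i j)%:E =
       covariance (std_gaussian n) (peval (F i)) (peval (F j))) ->
  forall (dT : measure_display) (T : measurableType dT) (Q : probability T R)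
         (G : {RV Q >-> r.-tuple R}),
    gaussian_vector G ->
    (forall i, 'E_Q[fun w => tnth (G w) i] = 0)%E ->
    (forall i j, covariance Q (fun w => tnth (G w) i) (fun w => tnth (G w) j)
       = (C i j)%:E) ->
  forall alpha : 'rV[R]_r -> R,
    C2 alpha ->
    has_ubound (second_partials alpha) ->
    (`| 'E_(std_gaussian n)[fun x => alpha (\row_(i < r) peval (F i) x)]
        - 'E_Q[fun w => alpha (\row_(i < r) tnth (G w) i)] |
     <= (2 `^ (K * d%:R * ln d%:R) * r%:R ^+ 2 * Num.sqrt eps
         * sup (second_partials alpha))%:E)%E.
Proof.
exists (5 / ln 2) => d n r eps F C d2 _ EF VF regF covF dT T Q G [k [A [m law]]] EG covG
  alpha alphaC2 alpha_bd.
have /choice[p pP] i := eigenregular_mpoly (regF i) (EF i) (VF i).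
have {pP} /choice[u pu] := pP.
rewrite chaos_constantE//; set M := sup (second_partials alpha).
have alphaM i j x : `|partial i (partial j alpha) x| <= M.
  by apply: ub_le_sup => //; exists i, j, x.
pose g i : mpoly k R := linform (A i).
have pg i := polyb_peval (g i).
have tnth_affine m' i z : tnth (affine_tuple A m' z) i = m' i + peval (g i) z.
  by rewrite tnth_mktuple /peval meval_linform.
(* The law leaves [m] and [A] free; testing it on coordinates gives m = 0, and on products of
   coordinates it identifies A A^T with C. *)
have m0 : m = fun=> 0.
  apply/funext => i; have := EG i.
  rewrite (expectation_gaussian_law (f := fun y => tnth y i) law); last 2 first.
  - exact: measurable_tnth.
  - rewrite /comp; under eq_fun do rewrite tnth_affine.
    exact: polybD (polyb_cst _ _) (pg i).
  rewrite /comp; under [X in expect X]eq_fun do rewrite tnth_affine.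
  rewrite expectD ?expect_cst//; last exact: polyb_cst.
  by rewrite -/(mexpect (g i)) mexpect_linform addr0 => -[].
subst m.
have {}tnth_affine i z : tnth (affine_tuple A (fun=> 0) z) i = peval (g i) z.
  by rewrite tnth_affine add0r.
(* Gradients of linear forms are constant, so the Gaussian part of the defect is exactly C_ij and
   merely centres the other part. *)
have gC i j : grad_dot (g i) (g j) = C i j *: 1.
  have := covG i j; rewrite centered_covariance//.
  rewrite (expectation_gaussian_law (f := fun y => tnth y i * tnth y j) law); last 2 first.
  - by apply: measurable_funM; exact: measurable_tnth.
  - rewrite /comp; under eq_fun do rewrite !tnth_affine.
    exact: polybM.
  rewrite /comp; under [X in expect X]eq_fun do rewrite !tnth_affine.
  rewrite -peval_mul -/(mexpect _) mexpect_linformM grad_dot_linform => -[->].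
  by [].
have EQ : ('E_Q[(fun w => alpha (\row_(i < r) tnth (G w) i))%R] =
    (expect (fun z => alpha (prow g z)))%:E)%E.
  have comp : (fun y : r.-tuple R => alpha (\row_i tnth y i)) \o affine_tuple A (fun=> 0) =
      fun z => alpha (prow g z).
    apply/funext => z /=; congr alpha; apply/rowP => i.
    by rewrite !mxE tnth_affine.
  have := expectation_gaussian_law (f := fun y => alpha (\row_i tnth y i)) law.
  rewrite comp; apply.
  - apply: measurable_row => [|i]; [by case: alphaC2 => -[] | exact: measurable_tnth].
  - exact: polyb_C2 alphaC2 alphaM g.
have pp i : peval (p i) = peval (F i) by have [] := pu i.
have EF' : ('E_(std_gaussian n)[(fun x => alpha (\row_(i < r) peval (F i) x))%R] =
    (expect (fun x => alpha (prow p x)))%:E)%E.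
  rewrite (_ : (fun x => _) = fun x => alpha (prow p x)).
    by rewrite expectation_gauss//; exact: polyb_C2 alphaC2 alphaM p.
  by apply/funext => x; congr alpha; apply/rowP => i; rewrite !mxE pp.
rewrite EQ EF' -EFinB lee_fin => {EQ EF'}.
(* F occupies the first n and G the last k of n + k coordinates. Disjointness kills the mixed
   gradient products, and marginals recover the separate expectations. *)
pose sl := @lshift n k; pose sr := @rshift n k.
pose f' i := relabel sl (p i); pose uf i := relabel sl (u i).
pose g' i := relabel sr (g i).
have sl_inj : injective sl := @lshift_inj n k.
have sr_inj : injective sr := @rshift_inj n k.
have fE i : f' i = numop (uf i).
  by rewrite /f' /uf numop_relabel//; have [_ ->] := pu i.
have gE i : g' i = numop (g' i) by rewrite /g' numop_relabel// numop_linform.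
have uf_g i j : grad_dot (uf i) (g' j) = 0.
  by apply: grad_dot_relabel_disjoint => a b; rewrite eq_lrshift.
have g_f i j : grad_dot (g' i) (f' j) = 0.
  by rewrite grad_dotC; apply: grad_dot_relabel_disjoint => a b; rewrite eq_lrshift.
have := interpolation alphaC2 alphaM fE gE uf_g g_f.
have prowf x : prow f' x = prow p (subtuple sl x).
  by apply/rowP => i; rewrite !mxE peval_relabel.
have prowg x : prow g' x = prow g (subtuple sr x).
  by apply/rowP => i; rewrite !mxE peval_relabel.
have -> : expect (fun x => alpha (prow f' x)) = expect (fun x => alpha (prow p x)).
  rewrite /expect /Rintegral; under eq_integral do rewrite prowf.
  rewrite (@gauss_marginal_lshift _ n k (fun x => alpha (prow p x)))//.
    exact: polyb_C2 alphaC2 alphaM p.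
  by have := polyb_C2 alphaC2 alphaM f'; rewrite /comp; under eq_fun do rewrite prowf.
have -> : expect (fun x => alpha (prow g' x)) = expect (fun x => alpha (prow g x)).
  rewrite /expect /Rintegral; under eq_integral do rewrite prowg.
  rewrite (@gauss_marginal_rshift _ n k (fun x => alpha (prow g x)))//.
    exact: polyb_C2 alphaC2 alphaM g.
  move=> l; have := polyb_C2 alphaC2 alphaM (fun i => relabel (@rshift l k) (g i)).
  rewrite /comp; congr polyb; apply/funext => x; congr alpha; apply/rowP => i.
  by rewrite !mxE peval_relabel.
move=> /le_trans; apply.
have bd i j : expect (fun x => `|peval (grad_dot (uf i) (f' j) - grad_dot (g' i) (g' j)) x|) <=
    (chaos_constant d)%:R * Num.sqrt eps.
  have [_ _ [eps0 vi] [_ cui] ni] := pu i.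
  have [ppj _ [_ vj] [cpj _] nj] := pu j.
  (* Since p_i is [numop] of u_i, integration by parts makes this mean E[F_i F_j]. Thus C_ij is the
     true mean, and the L2 norm of the difference is a standard deviation. *)
  have yC : mexpect (grad_dot (u i) (p j)) = C i j.
    rewrite -(numop_ibp (@mexpect_ibp R n)); have [_ <- _ _ _] := pu i.
    have := covF i j; rewrite centered_covariance// -!pp -peval_mul.
    by rewrite expectation_gauss; [case|exact: polyb_peval].
  have py := polyb_peval (grad_dot (u i) (p j)).
  have := expect_grad_dot_le d2 eps0 (fun s ds => (vj s ds).1) (fun s ds => (vi s ds).2)
    cpj cui (fun q => (nj q).1) (fun q => (ni q).2) yC.
  have e x : peval (grad_dot (uf i) (f' j) - grad_dot (g' i) (g' j)) x =
      peval (grad_dot (u i) (p j)) (subtuple sl x) - C i j.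
    rewrite /uf /f' /g' !grad_dot_relabel// gC {1}/peval mevalB.
    rewrite -/(peval _ x) -/(peval _ x) !peval_relabel /peval mevalZ meval1 mulr1.
    by [].
  apply: le_trans; rewrite le_eqVlt; apply/orP; left; apply/eqP.
  rewrite /expect /Rintegral; under eq_integral do rewrite e.
  rewrite (@gauss_marginal_lshift _ n k (fun x => `|peval (grad_dot (u i) (p j)) x - C i j|))//.
    by apply: polyb_norm; exact: polybD py (polyb_cst _ _).
  have := polyb_norm (polyb_peval (grad_dot (uf i) (f' j) - grad_dot (g' i) (g' j))).
  by rewrite /comp; under eq_fun do rewrite e.
(* For r = 0 there is no second partial derivative from which to read off M >= 0; both sides are
   then 0. *)
have [r0|r0] := posnP r.
  rewrite big1 ?mulr0 ?r0 ?expr0n ?mulr0 ?mul0r// => i _.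
  by have := ltn_ord i; rewrite {2}r0.
have M0 : 0 <= M.
  exact: le_trans (normr_ge0 _) (alphaM (Ordinal r0) (Ordinal r0) 0).
rewrite [leRHS]mulrC ler_wpM2l//.
apply: (@le_trans _ _ (\sum_(i < r) \sum_(j < r) (chaos_constant d)%:R * Num.sqrt eps)).
  by apply: ler_sum => i _; apply: ler_sum => j _; exact: bd.
rewrite !sumr_const card_ord -(mulr_natl (_ *+ r) r) -(mulr_natl _ r).
by rewrite le_eqVlt; apply/orP; left; apply/eqP; ring.
Qed.
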